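(* For all integers $n \geq 0$ and $k \geq 0$, $$\overline{R_6^*}\left(18\cdot 3^{2k+1}n+\frac{153\cdot 3^{2k}-1}{4}\right)\equiv 0 \pmod{128}.$$
   Context: An overpartition of a nonnegative integer $n$ is a partition of $n$ (a finite non-increasing sequence of positive integers summing to $n$) in which the first occurrence of each distinct part may optionally be overlined. For a positive integer $\ell$, $\overline{R_\ell^*}(n)$ denotes the number of overpartitions of $n$ in which no non-overlined part is divisible by $\ell$ (overlined parts are unrestricted); $\overline{R_\ell^*}(0)=1$. Equivalently, $\sum_{n\ge 0}\overline{R_\ell^*}(n)q^n = \frac{f_2 f_\ell}{f_1^2}$, where $f_k=\prod_{m\ge 1}(1-q^{km})$. Here $\ell=6$. *)

(* Defs.v *)
From mathcomp Require Import all_boot.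
Set Implicit Arguments. Unset Strict Implicit. Unset Printing Implicit Defensive.

(* An overpartition is represented as the sequence of its parts listed in
   non-increasing order, each part paired with a flag [true] = overlined.
   Within a run of equal parts only the first one may be overlined. *)

Definition op_rel (x y : nat * bool) : bool :=
  (y.1 < x.1) || ((y.1 == x.1) && ~~ y.2).

Definition is_overpartition (n : nat) (s : seq (nat * bool)) : bool :=
  [&& sorted op_rel s, all (fun p => 0 < p.1) s & sumn (map fst s) == n].

Fixpoint all_seqs (T : Type) (alph : seq T) (k : nat) : seq (seq T) :=
  if k is k'.+1 then [seq x :: s | x <- alph, s <- all_seqs alph k'] else [:: [::]].

(* every overpartition of n has at most n parts, each in 1..n *)
Definition op_candidates (n : nat) : seq (seq (nat * bool)) :=
  flatten [seq all_seqs [seq (a, b) | a <- iota 1 n, b <- [:: true; false]] k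
          | k <- iota 0 n.+1].

Definition R_star_ok (l : nat) (s : seq (nat * bool)) : bool :=
  all (fun p => p.2 || ~~ (l %| p.1)) s.

Definition Rbar_star (l n : nat) : nat :=
  count (fun s => is_overpartition n s && R_star_ok l s) (op_candidates n).

(* Main.v *)
Require Import Defs.
From HB Require Import structures.
From mathcomp Require Import all_boot all_order all_algebra.
From mathcomp Require Import boolp zify ring.
Set Implicit Arguments. Unset Strict Implicit. Unset Printing Implicit Defensive.
Import Order.TTheory GRing.Theory Num.Theory.

(** Write f_k for the product of the (1 - q^(k m)), theta = f_1^2 / f_2 for the sum of
    (-1)^n q^(n^2) over all integers n, and a = theta(q^3), so that the generating
    function of the regular overpartitions is f_6 / theta. Multiplying over the cube
    roots of unity, the 3-dissection theta = theta(q^9) - 2 q omega(q^3) yields a (a^3 -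
    8 q omega^3) = theta^4, and hence closed forms for the subseries of indices 3n+2 and
    then 9n+2. With theta^4 = 1 + 8 Y, the latter is 4 (f_2^3 a^5 + 16 f_2^3 Y) modulo
    128. The map sending (c_n) to (c_(9n+2)) preserves, modulo 32, the span of f_2^3 a^5
    and of 16 f_2^3 times 1, Y(q^3) and Y, and every series in this span has
    coefficients divisible by 32 at the indices 6n+4: by Jacobi's identity f_2^3 has no
    exponent congruent to 1 modulo 3, and f_2^3 Y is handled modulo 2, where f_1 omega =
    f_3^3. The product expansions of theta, omega, f_1 and f_1^3 are all instances of
    the Jacobi triple product. *)

Open Scope ring_scope.

(** * Formal power series *)

(** The map n -> 9n + 2 multiplies 4n + 1 by 9. An index N of the theorem satisfies 4N + 1 = 9^(k+1)
    (24n + 17), and 24n + 17 = 4(6n + 4) + 1, so N arises from 6n + 4 by k + 1 applications of the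
    map. The first extraction supplies the factor 4 of 128, the span the remaining 32. The shape of
    the span comes from f_2^3 a^5: the map scales it by -3 up to the exact error 240 f_2^3 a (Y(q^3)
    - Y). As 240 is 16 modulo 32 and a is odd, this error brings in Y and Y(q^3), and the image of
    f_2^3 Y in turn brings in f_2^3; the common factor 16 leaves only parities to compute there. The
    dissection of Y is that of theta^4 divided by 8, hence is derived over the integers before any
    reduction. The base ring of the series is left general so that coefficients may themselves be
    series, as the proof of Jacobi's identity requires. *)

Record fps (R : comNzRingType) := Fps { fps_coef :> nat -> R }.

HB.instance Definition _ (R : comNzRingType) := [isNew for @fps_coef R].
HB.instance Definition _ (R : comNzRingType) := [Choice of fps R by <:].

Lemma fpsP (R : comNzRingType) (F G : fps R) : F =1 G -> F = G.
Proof. by case: F G => [f] [g] /= /funext ->. Qed.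

Definition trunc (R : comNzRingType) n (F : fps R) : {poly R} :=
  \poly_(i < n) F i.

(** Going through truncated polynomials lets the ring axioms be inherited from [{poly R}]. *)
HB.lock Definition fps_mul (R : comNzRingType) (F G : fps R) : fps R :=
  Fps (fun n => (trunc n.+1 F * trunc n.+1 G)`_n).

Section Ring.
Variable R : comNzRingType.
Implicit Types F G H : fps R.

Definition fps_zero : fps R := Fps (fun=> 0).
Definition fps_one : fps R := Fps (fun n => (n == 0)%:R).
Definition fps_opp F : fps R := Fps (fun n => - F n).
Definition fps_add F G : fps R := Fps (fun n => F n + G n).

Lemma fps_mulE F G n : fps_mul F G n = \sum_(i < n.+1) F i * G (n - i)%N.
Proof.
rewrite fps_mul.unlock [LHS]coefM; apply: eq_bigr => i _.
by rewrite !coef_poly ltn_ord ltnS leq_subr.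
Qed.

Lemma coef_trunc_mul m F G n : (n < m)%N ->
  (trunc m F * trunc m G)`_n = fps_mul F G n.
Proof.
move=> ltnm; rewrite fps_mulE coefM; apply: eq_bigr => i _.
rewrite !coef_poly (leq_trans (ltn_ord i)) //.
by rewrite (leq_ltn_trans (leq_subr _ _)).
Qed.

Fact fps_addA : associative fps_add.
Proof. by move=> F G H; apply: fpsP => n /=; rewrite addrA. Qed.
Fact fps_addC : commutative fps_add.
Proof. by move=> F G; apply: fpsP => n /=; rewrite addrC. Qed.
Fact fps_add0 : left_id fps_zero fps_add.
Proof. by move=> F; apply: fpsP => n /=; rewrite add0r. Qed.
Fact fps_addN : left_inverse fps_zero fps_opp fps_add.
Proof. by move=> F; apply: fpsP => n /=; rewrite addNr. Qed.

HB.instance Definition _ :=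
  GRing.isZmodule.Build (fps R) fps_addA fps_addC fps_add0 fps_addN.

Fact fps_mulC : commutative (@fps_mul R).
Proof. by move=> F G; apply: fpsP => n; rewrite fps_mul.unlock /= mulrC. Qed.
Fact fps_mulA : associative (@fps_mul R).
Proof.
move=> F G H; apply: fpsP => n; pose t := @trunc R n.+1.
transitivity ((t F * (t G * t H))`_n).
  rewrite fps_mulE coefM; apply: eq_bigr => i _.
  by rewrite coef_trunc_mul ?coef_poly ?ltn_ord // ltnS leq_subr.
rewrite mulrA fps_mulE coefM; apply: eq_bigr => i _.
by rewrite coef_trunc_mul ?coef_poly ?ltn_ord ?ltnS ?leq_subr.
Qed.
Fact fps_mul1 : left_id fps_one (@fps_mul R).
Proof.
move=> F; apply: fpsP => n; rewrite fps_mulE big_ord_recl /= mul1r subn0.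
by rewrite big1 ?addr0 // => i _; rewrite mul0r.
Qed.
Fact fps_mulDl : left_distributive (@fps_mul R) fps_add.
Proof.
move=> F G H; apply: fpsP => n.
transitivity (fps_mul F H n + fps_mul G H n) => //.
by rewrite !fps_mulE -big_split; apply: eq_bigr => i _; rewrite mulrDl.
Qed.
Fact fps_one_neq0 : fps_one != 0.
Proof.
by apply/eqP => /(congr1 (fun F : fps R => F 0%N)) /= /eqP; rewrite oner_eq0.
Qed.
HB.instance Definition _ := GRing.Zmodule_isComNzRing.Build (fps R)
  fps_mulA fps_mulC fps_mul1 fps_mulDl fps_one_neq0.

Lemma fcoef0 n : (0 : fps R) n = 0. Proof. by []. Qed.
Lemma fcoef1 n : (1 : fps R) n = (n == 0)%:R. Proof. by []. Qed.
Lemma fcoefD F G n : (F + G) n = F n + G n. Proof. by []. Qed.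
Lemma fcoefN F n : (- F) n = - F n. Proof. by []. Qed.
Lemma fcoefB F G n : (F - G) n = F n - G n. Proof. by []. Qed.
Lemma fcoefM F G n : (F * G) n = \sum_(i < n.+1) F i * G (n - i)%N.
Proof. exact: fps_mulE. Qed.
Lemma fcoef_sum (I : Type) (r : seq I) (P : pred I) (f : I -> fps R) n :
  (\sum_(i <- r | P i) f i) n = \sum_(i <- r | P i) f i n.
Proof. exact: (big_morph (fun F : fps R => F n) (fun _ _ => erefl)). Qed.
Lemma fcoefMn F k n : (F *+ k) n = F n *+ k.
Proof. by elim: k => // k IH; rewrite !mulrS fcoefD IH. Qed.
Lemma fcoefM0 F G : (F * G) 0%N = F 0%N * G 0%N.
Proof. by rewrite fcoefM big_ord1. Qed.
Lemma fcoefM1 F G : (F * G) 1%N = F 0%N * G 1%N + F 1%N * G 0%N.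
Proof. by rewrite fcoefM big_ord_recl big_ord1. Qed.

Definition fps_const c : fps R := Fps (fun n => if n == 0 then c else 0).
Definition fps_X : fps R := Fps (fun n => (n == 1)%:R).

Lemma fcoefCM c F n : (fps_const c * F) n = c * F n.
Proof.
rewrite fcoefM big_ord_recl /= subn0 big1 ?addr0 // => i _.
by rewrite mul0r.
Qed.

Lemma fcoefXnM k F n : (fps_X ^+ k * F) n = if (n < k)%N then 0 else F (n - k)%N.
Proof.
elim: k n => [|k IH] n; first by rewrite mul1r subn0.
rewrite exprS -mulrA fcoefM; case: n => [|n].
  by rewrite big_ord1 mul0r.
rewrite 2!big_ord_recl /= mul0r add0r mul1r big1 ?addr0 => [|i _].
  by rewrite subn1 /= IH ltnS subSS.
by rewrite mul0r.
Qed.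

Lemma fcoefXn k n : (fps_X ^+ k) n = (n == k)%:R.
Proof.
rewrite -[_ ^+ k]mulr1 fcoefXnM fcoef1; case: ltngtP => // [ltnk|->].
  by rewrite subn_eq0 leqNgt ltnk.
by rewrite subnn.
Qed.

(** Congruence modulo q^n. It replaces limits: identities between infinite sums and products are
    proved to each finite precision and closed by [agreeP]. *)
Definition agree n F G := forall i, (i < n)%N -> F i = G i.

Lemma agreeP F G : (forall n, agree n F G) -> F = G.
Proof. by move=> e; apply: fpsP => n; apply: (e n.+1). Qed.
Lemma agree_refl n F : agree n F F. Proof. by []. Qed.
Lemma agree_sym n F G : agree n F G -> agree n G F.
Proof. by move=> e i lt; rewrite e. Qed.
Lemma agree_trans n F G H : agree n F G -> agree n G H -> agree n F H.
Proof. by move=> e e' i lt; rewrite e // e'. Qed.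
Lemma agree_le m n F G : (m <= n)%N -> agree n F G -> agree m F G.
Proof. by move=> le e i lt; apply: e; apply: leq_trans le. Qed.
Lemma agreeD n F G F' G' :
  agree n F F' -> agree n G G' -> agree n (F + G) (F' + G').
Proof. by move=> e e' i lt; rewrite !fcoefD e ?e'. Qed.
Lemma agreeN n F G : agree n F G -> agree n (- F) (- G).
Proof. by move=> e i lt; rewrite !fcoefN e. Qed.
Lemma agreeM n F G F' G' :
  agree n F F' -> agree n G G' -> agree n (F * G) (F' * G').
Proof.
move=> e e' i lt; rewrite !fcoefM; apply: eq_bigr => j _.
by rewrite e ?e' //; [rewrite (leq_ltn_trans (leq_subr _ _))
  |rewrite (leq_trans (ltn_ord j))].
Qed.
Lemma agree_sum n (I : Type) (r : seq I) (P : pred I) (f g : I -> fps R) :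
  (forall i, P i -> agree n (f i) (g i)) ->
  agree n (\sum_(i <- r | P i) f i) (\sum_(i <- r | P i) g i).
Proof. by move=> e j lt; rewrite !fcoef_sum; apply: eq_bigr => i /e ->. Qed.
Lemma agree_prod n (I : Type) (r : seq I) (P : pred I) (f g : I -> fps R) :
  (forall i, P i -> agree n (f i) (g i)) ->
  agree n (\prod_(i <- r | P i) f i) (\prod_(i <- r | P i) g i).
Proof.
move=> e; elim/big_ind2: _ => // F F' G G'; exact: agreeM.
Qed.

Lemma agree_Xn_mul k F : agree k (fps_X ^+ k * F) 0.
Proof. by move=> i lt; rewrite fcoefXnM lt. Qed.

Lemma agree_expand n F :
  agree n F (\sum_(j < n) fps_const (F j) * fps_X ^+ j).
Proof.
move=> i lt; rewrite fcoef_sum (bigD1 (Ordinal lt)) //=.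
rewrite fcoefCM fcoefXn eqxx mulr1 big1 ?addr0 // => j ne.
by move: ne; rewrite -val_eqE /= eq_sym fcoefCM fcoefXn => /negPf->; rewrite mulr0.
Qed.

(** A total definition: coefficient n is read off the first n + 1 terms. Under [summable] the later
    terms have order above n, so this is the true limit. In [iprod], n factors suffice because
    [multipliable] asks for factors 1 + O(q^(k+1)). *)
Definition ssum (f : nat -> fps R) : fps R :=
  Fps (fun n => (\sum_(k < n.+1) f k) n).
Definition summable (f : nat -> fps R) := forall k, agree k (f k) 0.

Lemma ssum_agree n f : summable f -> agree n (ssum f) (\sum_(k < n) f k).
Proof.
move=> sf i lt; rewrite -(subnKC lt); elim: (n - _)%N => [|d IH].
  by rewrite addn0.
by rewrite addnS big_ord_recr fcoefD -IH sf ?fcoef0 ?addr0 //= leq_addr.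
Qed.

Definition iprod (f : nat -> fps R) : fps R :=
  Fps (fun n => (\prod_(k < n) f k) n).
Definition multipliable (f : nat -> fps R) := forall k, agree k.+1 (f k) 1.

Lemma iprod_agree n f : multipliable f -> agree n.+1 (iprod f) (\prod_(k < n) f k).
Proof.
move=> sf i; rewrite ltnS => /subnKC <-.
suff: agree i.+1 (\prod_(k < i) f k) (\prod_(k < i + (n - i)) f k) by exact.
elim: (n - i)%N => [|d IH]; first by rewrite addn0.
rewrite addnS big_ord_recr /= -[\prod_(k < i) _]mulr1; apply: agreeM => //.
by apply/agree_sym/(agree_le _ (sf _)); rewrite ltnS leq_addr.
Qed.

(** The inverse is the geometric series in 1 - F. *)
Lemma fps_unit F : F 0%N = 1 -> exists G, F * G = 1.
Proof.
move=> F0; pose E := 1 - F; have E0: agree 1 E 0.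
  by case=> // _; rewrite fcoefB F0 fcoef1 subrr.
have EX k : agree k (E ^+ k) 0.
  elim: k => // k IH i lt; rewrite exprS fcoefM big1 // => j _.
  case: (posnP j) => [->|j0]; first by rewrite E0 ?mul0r.
  by rewrite IH ?mulr0 //; have := ltn_ord j; lia.
exists (ssum (fun k => E ^+ k)); apply: agreeP => n.
apply: agree_trans (agreeM (@agree_refl n F) (@ssum_agree _ _ EX)) _.
have -> : F * \sum_(k < n) E ^+ k = 1 - E ^+ n.
  rewrite -[1](expr1n _ n) subrXX /E; congr (_ * _); first by ring.
  by apply: eq_bigr => i _; rewrite expr1n mul1r.
by rewrite -[1 in X in agree _ _ X]subr0; apply: agreeD => //; apply: agreeN.
Qed.

Lemma fps_lcancel F G H : F 0%N = 1 -> F * G = F * H -> G = H.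
Proof.
move=> /fps_unit[F' F'K] e.
by rewrite -[G]mul1r -[H]mul1r -F'K [F * F']mulrC -!mulrA e.
Qed.

End Ring.

Arguments fps_X {R}.

Lemma big_dissect (T : Type) (idx : T) (op : Monoid.com_law idx) m n f :
  \big[op/idx]_(k < m * n) f (k : nat) =
  \big[op/idx]_(c < m) \big[op/idx]_(j < n) f (m * j + c)%N.
Proof.
elim: n => [|n IH].
  by rewrite muln0 big_ord0 big1 // => c _; rewrite big_ord0.
rewrite mulnS addnC big_split_ord /= IH -big_split /=.
by apply: eq_bigr => c _; rewrite big_ord_recr.
Qed.

(** * Infinite sums and products, the substitution q -> q^k, extraction of progressions *)

Section Limits.
Variable R : comNzRingType.
Implicit Types (F G H : fps R) (f g : nat -> fps R).

Lemma agreeMX n k F : (n <= k)%N -> agree n (fps_X ^+ k * F) 0.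
Proof. by move=> le; apply: agree_le le _; apply: agree_Xn_mul. Qed.

Lemma agreeMr n F G : agree n F 0 -> agree n (F * G) 0.
Proof. by move=> F0; rewrite -(mul0r G); apply: agreeM. Qed.
Lemma agreeMl n F G : agree n G 0 -> agree n (F * G) 0.
Proof. by rewrite mulrC; apply: agreeMr. Qed.

Lemma eq_ssum f g : f =1 g -> ssum f = ssum g.
Proof.
by move=> e; apply: fpsP => n /=; congr fps_coef; apply: eq_bigr => i _.
Qed.

Lemma ssumMl F f : summable f -> F * ssum f = ssum (fun k => F * f k).
Proof.
move=> sf; apply: agreeP => n.
apply: agree_trans (agreeM (@agree_refl _ n F) (ssum_agree sf)) _.
rewrite mulr_sumr; apply: agree_sym; apply: ssum_agree => k.
exact/agreeMl/sf.
Qed.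

Lemma ssumD f g :
  ssum f + ssum g = ssum (fun k => f k + g k).
Proof.
by apply: fpsP => n; rewrite /= !big_split.
Qed.

Lemma ssum_recl f : summable f -> ssum f = f 0%N + ssum (fun k => f k.+1).
Proof.
move=> sf; apply: agreeP => n.
apply: agree_trans (agree_le (leqnSn n) (ssum_agree sf)) _.
rewrite big_ord_recl; apply: agreeD => //; apply/agree_sym/ssum_agree => k.
exact: agree_le (leqnSn k) (sf _).
Qed.

Lemma ssum_dissect m f : (0 < m)%N -> summable f ->
  ssum f = \sum_(c < m) ssum (fun j => f (m * j + c)%N).
Proof.
move=> m0 sf; apply: agreeP => n.
apply: (@agree_trans _ n _ (\sum_(k < m * n) f k)).
  by apply: agree_le (ssum_agree sf); rewrite leq_pmull.
rewrite (big_dissect _ _ _ f); apply: agree_sum => c _.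
apply/agree_sym/ssum_agree => j; apply: agree_le (sf _).
by rewrite (leq_trans (leq_pmull j m0)) ?leq_addr.
Qed.

Lemma multipliable1X f g (e : nat -> nat) :
  (forall k, k < e k)%N -> (forall k, f k = 1 + fps_X ^+ e k * g k) ->
  multipliable f.
Proof.
by move=> le ef k; rewrite ef -[X in agree _ _ X]addr0; apply: agreeD => //; apply: agreeMX.
Qed.

Lemma multipliableM f g : multipliable f -> multipliable g ->
  multipliable (fun k => f k * g k).
Proof. by move=> sf sg k; rewrite -[X in agree _ _ X]mulr1; apply: agreeM. Qed.

Lemma eq_iprod f g : f =1 g -> iprod f = iprod g.
Proof.
by move=> e; apply: fpsP => n /=; congr fps_coef; apply: eq_bigr => i _.
Qed.

Lemma iprod0 f : iprod f 0%N = 1.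
Proof. by rewrite /= big_ord0. Qed.

Lemma iprod1 : iprod (fun=> 1 : fps R) = 1.
Proof. by apply: fpsP => n; rewrite /= big1. Qed.

Lemma iprodM f g : multipliable f -> multipliable g ->
  iprod f * iprod g = iprod (fun k => f k * g k).
Proof.
move=> sf sg; apply: agreeP => n; apply: (@agree_le _ n n.+1) => //.
apply: agree_trans (agreeM (iprod_agree sf) (iprod_agree sg)) _.
by rewrite -big_split; apply/agree_sym/iprod_agree/multipliableM.
Qed.

Lemma multipliable_dissect m f c : (0 < m)%N -> multipliable f ->
  multipliable (fun j => f (m * j + c)%N).
Proof.
move=> m0 sf j; apply: agree_le (sf _).
by rewrite ltnS (leq_trans (leq_pmull j m0)) ?leq_addr.
Qed.

Lemma iprod_dissect m f : (0 < m)%N -> multipliable f ->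
  iprod f = \prod_(c < m) iprod (fun j => f (m * j + c)%N).
Proof.
move=> m0 sf; apply: agreeP => n; apply: (@agree_le _ n n.+1) => //.
apply: (@agree_trans _ n.+1 _ (\prod_(k < m * n) f k)).
  by apply: agree_le (iprod_agree sf); rewrite ltnS leq_pmull.
rewrite (big_dissect _ _ _ f); apply: agree_prod => c _.
exact/agree_sym/iprod_agree/multipliable_dissect.
Qed.

(** Additivity and continuity reduce an identity to monomials; this is how [V k] is shown to be
    multiplicative. *)
Lemma lin_eq (A B : fps R -> fps R) :
  {morph A : F G / F + G} -> {morph B : F G / F + G} ->
  (forall n, exists N, forall F G, agree N F G -> A F n = A G n /\ B F n = B G n) ->
  (forall c k, A (fps_const c * fps_X ^+ k) = B (fps_const c * fps_X ^+ k)) ->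
  A =1 B.
Proof.
move=> AD BD cont mono F; apply: fpsP => n; have [N cN] := cont n.
have [-> ->] := cN _ _ (@agree_expand _ N F).
have A0: A 0 = 0 by apply: (addrI (A 0)); rewrite -AD !addr0.
have B0: B 0 = 0 by apply: (addrI (B 0)); rewrite -BD !addr0.
rewrite (big_morph A AD A0) (big_morph B BD B0); congr fps_coef.
by apply: eq_bigr => j _.
Qed.

(* V k is the substitution q -> q^k; for k = 0 it evaluates at q = 0. *)
Definition V k F : fps R := Fps (fun n => if (k %| n)%N then F (n %/ k)%N else 0).
Definition U k r F : fps R := Fps (fun n => F (k * n + r)%N).

Fact V_additive k : zmod_morphism (V k).
Proof. by move=> F G; apply: fpsP => n; rewrite fcoefB /=; case: ifP; rewrite ?subrr. Qed.
HB.instance Definition _ k := GRing.isZmodMorphism.Build _ _ (V k) (V_additive k).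
Fact U_additive k r : zmod_morphism (U k r).
Proof. by move=> F G; apply: fpsP => n; rewrite fcoefB. Qed.
HB.instance Definition _ k r := GRing.isZmodMorphism.Build _ _ (U k r) (U_additive k r).

Lemma agree_V k n F G : (0 < k)%N -> agree n F G -> agree n (V k F) (V k G).
Proof.
by move=> k0 e i lt /=; case: ifP => // _; apply: e; apply: leq_ltn_trans (leq_div _ _) lt.
Qed.

Lemma V_const k c F : (0 < k)%N -> V k (fps_const c * F) = fps_const c * V k F.
Proof.
by move=> k0; apply: fpsP => n; rewrite fcoefCM /= fcoefCM; case: ifP; rewrite ?mulr0.
Qed.

Lemma V_XnM k j F : (0 < k)%N -> V k (fps_X ^+ j * F) = fps_X ^+ (k * j) * V k F.
Proof.
move=> k0; apply: fpsP => n; rewrite fcoefXnM /= fcoefXnM.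
case: (ltnP n (k * j)) => [lt|le].
  by rewrite ltn_divLR // mulnC lt; case: ifP.
rewrite ltnNge leq_divRL // mulnC le /=.
rewrite -{1 2}(subnKC le) dvdn_addr ?dvdn_mulr //.
by rewrite divnDl ?dvdn_mulr // mulKn // addKn.
Qed.

Fact V1 k : V k 1 = 1.
Proof.
apply: fpsP => -[|n] /=; first by rewrite dvdn0 div0n.
case: ifP => // /dvdnP[[|j] e] //; case: k e => [|k] e; first by rewrite muln0 in e.
by rewrite e mulnK.
Qed.

Fact V_mul k : monoid_morphism (V k).
Proof.
split; first exact: V1.
(* The case k = 0 is apart because the shift and continuity rules for [V k] need k > 0; treating it
   makes the morphism instance unconditional. *)
move=> F G; case: (posnP k) => [->|k0].
  apply: fpsP => n; rewrite /= dvd0n; case: eqP => [->|n0].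
    by rewrite div0n !fcoefM0 /=.
  rewrite fcoefM big1 // => i _ /=; rewrite !dvd0n; case: eqP => [->|];
    last by rewrite mul0r.
  by rewrite subn0; case: eqP n0 => // _ _; rewrite mulr0.
apply: (lin_eq (A := fun F => V k (F * G)) (B := fun F => V k F * V k G)) F.
- by move=> F F' /=; rewrite mulrDl raddfD.
- by move=> F F' /=; rewrite raddfD mulrDl.
- move=> n; exists n.+1 => F F' e; split.
    by apply: (@agree_V k n.+1) => //; apply: agreeM.
  by apply: (@agreeM _ n.+1) => //; apply: agree_V.
move=> c j /=; rewrite -mulrA !V_const // V_XnM // -[fps_X ^+ j]mulr1 V_XnM //.
by rewrite V1 mulr1 mulrA.
Qed.

End Limits.

(** * Dissections *)

Section Dissection.
Variable R : comNzRingType.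
Implicit Types (A B C F G H : fps R) (f g : nat -> fps R).

HB.instance Definition _ k := GRing.isMonoidMorphism.Build _ _ (@V R k) (@V_mul R k).

Lemma V_X k : (0 < k)%N -> V k fps_X = fps_X ^+ k :> fps R.
Proof.
by move=> k0; rewrite -{1}[fps_X]expr1 -[X in V k X]mulr1 V_XnM // rmorph1 mulr1 muln1.
Qed.

Lemma V_comp j k F : (0 < j)%N -> (0 < k)%N -> V j (V k F) = V (j * k) F.
Proof.
move=> j0 k0; apply: fpsP => n /=; rewrite divnMA.
case: (boolP (j %| n)%N) => [/dvdnP[m ->]|].
  by rewrite mulnK // [(m * j)%N]mulnC dvdn_pmul2l.
by move=> h; case: ifP => // /(dvdn_trans (dvdn_mulr k (dvdnn j))); rewrite (negPf h).
Qed.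

Lemma V_id F : V 1 F = F.
Proof. by apply: fpsP => n /=; rewrite dvd1n divn1. Qed.

Lemma V_ssum k f : (0 < k)%N -> summable f -> V k (ssum f) = ssum (fun j => V k (f j)).
Proof.
move=> k0 sf; apply: agreeP => n; apply: agree_trans (agree_V k0 (ssum_agree sf)) _.
rewrite rmorph_sum; apply/agree_sym/ssum_agree => j.
by rewrite -[X in agree _ _ X](rmorph0 (V k)); apply: agree_V.
Qed.

Lemma V_iprod k f : (0 < k)%N -> multipliable f ->
  V k (iprod f) = iprod (fun j => V k (f j)).
Proof.
move=> k0 sf; apply: agreeP => n; apply: (@agree_le _ n n.+1) => //.
apply: agree_trans (agree_V k0 (iprod_agree sf)) _.
rewrite rmorph_prod; apply/agree_sym/iprod_agree => j.
by rewrite -[X in agree _ _ X](rmorph1 (V k)); apply: agree_V.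
Qed.

Lemma U_XnV k r i F : (r < k)%N -> (i < k)%N ->
  U k r (fps_X ^+ i * V k F) = if i == r then F else 0.
Proof.
move=> rk ik; apply: fpsP => n; rewrite /= fcoefXnM.
have k0 : (0 < k)%N by apply: leq_ltn_trans rk.
case: eqP => [->|ne].
  by rewrite ltnNge leq_addl /= addnK dvdn_mulr // mulKn.
case: ltnP => // le /=; case: ifP => // /dvdnP[m e].
have {}e : (m * k + i)%N = (n * k + r)%N by lia.
by case: ne; have := congr1 (modn^~ k) e; rewrite !modnMDl !modn_small.
Qed.

Lemma dissect k F : (0 < k)%N -> F = \sum_(c < k) fps_X ^+ c * V k (U k c F).
Proof.
move=> k0; apply: fpsP => n; rewrite fcoef_sum.
rewrite (bigD1 (Ordinal (ltn_pmod n k0))) //= fcoefXnM ltnNge leq_mod /=.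
have e : (n - n %% k)%N = (n %/ k * k)%N by rewrite {1}(divn_eq n k) addnK.
rewrite e dvdn_mull // mulnK // mulnC -divn_eq big1 ?addr0 // => c ne.
rewrite fcoefXnM; case: ltnP => // le /=; case: ifP => // /dvdnP[m em].
case/eqP: ne; apply: val_inj => /=.
by rewrite -(subnK le) em modnMDl modn_small.
Qed.

Lemma dissect3 F :
  F = V 3 (U 3 0 F) + fps_X * V 3 (U 3 1 F) + fps_X ^+ 2 * V 3 (U 3 2 F).
Proof. by rewrite {1}(@dissect 3 F) // !big_ord_recl big_ord0 mul1r expr1 addr0 addrA. Qed.

Lemma U2_eq A B : let F := V 2 A + fps_X * V 2 B in U 2 0 F = A /\ U 2 1 F = B.
Proof.
move=> F; rewrite {}/F.
have -> : V 2 A + fps_X * V 2 B = fps_X ^+ 0 * V 2 A + fps_X ^+ 1 * V 2 B.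
  by rewrite mul1r.
by rewrite /= !raddfD /= !U_XnV //= ?addr0 ?add0r.
Qed.

Lemma U3_eq A B C : let F := V 3 A + fps_X * V 3 B + fps_X ^+ 2 * V 3 C in
  [/\ U 3 0 F = A, U 3 1 F = B & U 3 2 F = C].
Proof.
move=> F; rewrite {}/F.
have -> : V 3 A + fps_X * V 3 B + fps_X ^+ 2 * V 3 C =
    fps_X ^+ 0 * V 3 A + fps_X ^+ 1 * V 3 B + fps_X ^+ 2 * V 3 C.
  by rewrite mul1r.
by rewrite /= !raddfD /= !U_XnV //= ?addr0 ?add0r.
Qed.

Lemma U3M F G :
  [/\ U 3 0 (F * G) = U 3 0 F * U 3 0 G
        + fps_X * (U 3 1 F * U 3 2 G + U 3 2 F * U 3 1 G),
      U 3 1 (F * G) = U 3 0 F * U 3 1 G + U 3 1 F * U 3 0 G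
        + fps_X * (U 3 2 F * U 3 2 G)
    & U 3 2 (F * G) = U 3 0 F * U 3 2 G + U 3 1 F * U 3 1 G + U 3 2 F * U 3 0 G].
Proof.
rewrite {1 5 9}[F]dissect3 {1 5 9}[G]dissect3.
set a := U 3 0 F; set b := U 3 1 F; set c := U 3 2 F.
set d := U 3 0 G; set e := U 3 1 G; set f := U 3 2 G.
have -> : (V 3 a + fps_X * V 3 b + fps_X ^+ 2 * V 3 c) *
  (V 3 d + fps_X * V 3 e + fps_X ^+ 2 * V 3 f) =
  V 3 (a * d + fps_X * (b * f + c * e)) + fps_X * V 3 (a * e + b * d + fps_X * (c * f))
  + fps_X ^+ 2 * V 3 (a * f + b * e + c * d).
  by rewrite !(rmorphM, rmorphD) /= V_X //; ring.
exact: U3_eq.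
Qed.

Lemma U_VM k r F G : (r < k)%N -> U k r (V k F * G) = F * U k r G.
Proof.
move=> rk; have k0 : (0 < k)%N by apply: leq_ltn_trans rk.
rewrite {1}[G](dissect _ k0) mulr_sumr raddf_sum (bigD1 (Ordinal rk)) //= big1.
  by rewrite addr0 mulrCA -rmorphM U_XnV // eqxx.
by move=> c; rewrite -val_eqE /= => /negPf ne; rewrite mulrCA -rmorphM U_XnV // ne.
Qed.

Lemma U_V k r F : (r < k)%N -> U k r (V k F) = if r == 0 then F else 0.
Proof.
move=> rk; have := @U_XnV k r 0 F rk (leq_ltn_trans (leq0n r) rk).
by rewrite mul1r eq_sym.
Qed.

(* The norm from q to q^3: the product of F(q), F(wq), F(w^2q) over the cube
   roots of unity is a power series in q^3, namely V 3 (norm3 F). *)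
Definition norm3 F : fps R :=
  U 3 0 F ^+ 3 + fps_X * U 3 1 F ^+ 3 + fps_X ^+ 2 * U 3 2 F ^+ 3
  - 3%:R * fps_X * U 3 0 F * U 3 1 F * U 3 2 F.

(** In terms of dissection components the norm is the determinant of multiplication by F, so
    multiplicativity is a polynomial identity and no cube root of unity is needed in R. *)
Lemma norm3M F G : norm3 (F * G) = norm3 F * norm3 G.
Proof. by rewrite /norm3; have [-> -> ->] := U3M F G; ring. Qed.

Lemma norm3_eq A B C :
  norm3 (V 3 A + fps_X * V 3 B + fps_X ^+ 2 * V 3 C) =
  A ^+ 3 + fps_X * B ^+ 3 + fps_X ^+ 2 * C ^+ 3 - 3%:R * fps_X * A * B * C.
Proof. by rewrite /norm3; have [-> -> ->] := U3_eq A B C. Qed.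

Lemma norm3_V3 A : norm3 (V 3 A) = A ^+ 3.
Proof.
have := norm3_eq A 0 0; rewrite !rmorph0 !(mulr0, addr0) => ->; ring.
Qed.

(** Squaring permutes the cube roots of unity; on components, q -> q^2 exchanges the classes 1 and 2
    modulo 3. *)
Lemma norm3_V2 F : norm3 (V 2 F) = V 2 (norm3 F).
Proof.
rewrite {1}[F]dissect3 !(rmorphD, rmorphM, rmorphXn) /= V_X // !V_comp //.
set a := U 3 0 F; set b := U 3 1 F; set c := U 3 2 F.
have -> : V (2 * 3) a + fps_X ^+ 2 * V (2 * 3) b + fps_X ^+ 2 ^+ 2 * V (2 * 3) c =
  V 3 (V 2 a) + fps_X * V 3 (fps_X * V 2 c) + fps_X ^+ 2 * V 3 (V 2 b).
  by rewrite rmorphM /= V_X // !V_comp //; ring.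
rewrite norm3_eq /norm3 -/a -/b -/c.
by rewrite rmorphN !rmorphM !rmorph_nat /= ?V_X //; ring.
Qed.

Lemma agree_norm3 n F G : agree (3 * n + 2)%N F G -> agree n (norm3 F) (norm3 G).
Proof.
move=> e; have eU r : (r < 3)%N -> agree n (U 3 r F) (U 3 r G).
  by move=> lt i lti /=; apply: e; lia.
rewrite /norm3 !exprS !expr0; repeat (first
  [exact: eU | exact: agree_refl | apply: agreeD | apply: agreeN | apply: agreeM]).
Qed.

Lemma norm3_iprod f : multipliable f -> multipliable (norm3 \o f) ->
  norm3 (iprod f) = iprod (norm3 \o f).
Proof.
move=> sf sg; have n1 : norm3 1 = 1 by have := norm3_V3 1; rewrite rmorph1 expr1n.
apply: agreeP => n; apply: (@agree_trans _ n _ (norm3 (\prod_(j < 3 * n + 2) f j))).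
  by apply: agree_norm3; apply: agree_le (iprod_agree sf).
rewrite (big_morph _ norm3M n1); apply/agree_sym/agree_le/(iprod_agree sg).
lia.
Qed.

End Dissection.

(** * The Jacobi triple product and its instances *)

Section GaussBinomial.
Variables (T : comNzRingType) (Q : T).

(** Gaussian binomials through a q-Pascal rule, which makes sense in any ring; the quotient of
    q-factorials is recovered without division in [gbin_qpoch]. *)
Fixpoint gbin n k : T :=
  match n, k with
  | _, 0 => 1
  | 0, _.+1 => 0
  | n'.+1, k'.+1 => gbin n' k + Q ^+ (n' - k') * gbin n' k'
  end.

Lemma gbin0 n : gbin n 0 = 1. Proof. by case: n. Qed.
Lemma gbinS n k : gbin n.+1 k.+1 = gbin n k.+1 + Q ^+ (n - k) * gbin n k.
Proof. by []. Qed.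
Arguments gbin : simpl never.
Lemma gbin_small n k : (n < k)%N -> gbin n k = 0.
Proof.
elim: n k => [|n IH] [|k] // lt; rewrite gbinS !IH ?mulr0 ?addr0 //; lia.
Qed.

Definition qpoch n : T := \prod_(i < n) (1 - Q ^+ i.+1).

Lemma qpochS n : qpoch n.+1 = qpoch n * (1 - Q ^+ n.+1).
Proof. exact: big_ord_recr. Qed.

Lemma gbin_qpoch k d : gbin (k + d) k * qpoch k * qpoch d = qpoch (k + d).
Proof.
have [n] := ubnP (k + d); elim: n k d => // n IH k d lt.
case: k lt => [|k] lt; first by rewrite gbin0 /qpoch big_ord0 !mul1r add0n.
rewrite addSn gbinS !mulrDl addKn [in RHS]qpochS -[(k + d)%N in LHS]/(k + d)%N.
have e1 : Q ^+ d * gbin (k + d) k * qpoch k.+1 * qpoch d =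
  Q ^+ d * (1 - Q ^+ k.+1) * qpoch (k + d).
  by rewrite -(IH k d) ?qpochS; [ring|lia].
have e2 : gbin (k + d) k.+1 * qpoch k.+1 * qpoch d = (1 - Q ^+ d) * qpoch (k + d).
  case: d lt {e1} => [|d] lt; first by rewrite addn0 gbin_small // expr0 subrr !mul0r.
  by rewrite addnS -addSn (qpochS d) mulrA IH ?addSn //; [rewrite mulrC|lia].
have -> : ((k + d).+1 = d + k.+1)%N by lia.
by rewrite {}e1 {}e2 exprD; ring.
Qed.

Definition jtp_term (a b : T) N k : T :=
  if (N <= k)%N then a ^+ (k - N) * Q ^+ 'C(k - N, 2)
  else b ^+ (N - k) * Q ^+ 'C(N - k, 2).

Lemma prod_gbin N (b : T) : \prod_(i < N) (1 + b * Q ^+ i) =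
  \sum_(k < N.+1) gbin N k * (b ^+ (N - k) * Q ^+ 'C(N - k, 2)).
Proof.
elim: N b => [|N IH] b; first by rewrite big_ord0 big_ord1 !mul1r.
rewrite big_ord_recl expr0 mulr1.
under eq_bigr => i _ do rewrite /bump /= ?add1n exprS mulrA.
rewrite IH mulrDl mul1r [in RHS]big_ord_recl gbin0 mul1r subn0.
under [in RHS]eq_bigr => k _ do rewrite /bump /= ?add1n gbinS subSS mulrDl.
rewrite big_split /= [RHS]addrA [LHS]addrC; congr (_ + _); last first.
  by apply: eq_bigr => k _; rewrite exprMn; ring.
rewrite big_ord_recl gbin0 mul1r subn0 mulrDr; congr (_ + _).
  by rewrite exprMn exprS binS bin1 exprD; ring.
rewrite big_ord_recr /= gbin_small // mul0r addr0 mulr_sumr.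
apply: eq_bigr => k _; rewrite /bump /= ?add1n.
have -> : (N - k = (N - k.+1).+1)%N by have := ltn_ord k; lia.
by rewrite exprMn exprS binS bin1 exprD; ring.
Qed.

(** A finite form of the triple product, by induction on M from the q-binomial theorem [prod_gbin]:
    each new factor 1 + a Q^M acts as one q-Pascal step. *)
Lemma finite_jtp M N (a b : T) : a * b = Q ->
  (\prod_(i < M) (1 + a * Q ^+ i)) * (\prod_(i < N) (1 + b * Q ^+ i)) =
  \sum_(k < (M + N).+1) gbin (M + N) k * jtp_term a b N k.
Proof.
move=> abQ; elim: M => [|M IH].
  rewrite big_ord0 mul1r add0n prod_gbin; apply: eq_bigr => k _; congr (_ * _).
  rewrite /jtp_term; case: leqP => // le.
  have -> : k = N :> nat by have := ltn_ord k; lia.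
  by rewrite subnn.
rewrite big_ord_recr /= mulrAC IH mulrDr mulr1 addSn.
(* Multiplication by a Q^M shifts the index by one: for j >= 0 it adds a factor a, for j < 0 it
   cancels a b through ab = Q. *)
have step k : (k <= M + N)%N ->
  jtp_term a b N k * (a * Q ^+ M) = Q ^+ (M + N - k) * jtp_term a b N k.+1.
  move=> le; rewrite /jtp_term; case: leqP => lk.
    rewrite leqW // subSn // binS bin1 exprD exprS.
    have eM : M = (M + N - k + (k - N))%N by lia.
    by rewrite {1}eM exprD; ring.
  have -> : (N - k = (N - k.+1).+1)%N by lia.
  have -> : (M + N - k = M + (N - k.+1) + 1)%N by lia.
  have -> : (if (N <= k.+1)%N then a ^+ (k.+1 - N) * Q ^+ 'C(k.+1 - N, 2)
      else b ^+ (N - k.+1) * Q ^+ 'C(N - k.+1, 2)) =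
      b ^+ (N - k.+1) * Q ^+ 'C(N - k.+1, 2).
    by case: leqP => // le'; have -> : N = k.+1; [lia | rewrite subnn].
  rewrite binS bin1 !exprD exprS expr1.
  transitivity (b ^+ (N - k.+1) * Q ^+ 'C(N - k.+1, 2) * Q ^+ (N - k.+1)
    * Q ^+ M * (a * b)).
    by ring.
  by rewrite abQ; ring.
rewrite mulr_suml.
have -> : \sum_(k < (M + N).+1) gbin (M + N) k * jtp_term a b N k * (a * Q ^+ M)
   = \sum_(k < (M + N).+1) Q ^+ (M + N - k) * gbin (M + N) k * jtp_term a b N k.+1.
  apply: eq_bigr => k _; rewrite -mulrA step; first by ring.
  by have := ltn_ord k; lia.
rewrite [in RHS]big_ord_recl gbin0.
under [in RHS]eq_bigr => k _ do rewrite /bump /= ?add1n gbinS mulrDl.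
rewrite big_split /= addrA; congr (_ + _).
rewrite big_ord_recl gbin0 [in RHS]big_ord_recr /= (@gbin_small _ (M + N).+1) //.
by rewrite mul0r addr0.
Qed.

End GaussBinomial.

Section TripleProduct.
Variable T : comNzRingType.
Implicit Types a b : fps T.
Local Notation X := (@fps_X T).

Definition euler : fps T := iprod (fun i => 1 - X ^+ i.+1).

Lemma multipliable_1BX (e : nat -> nat) : (forall k, k < e k)%N ->
  multipliable (fun k => 1 - X ^+ e k).
Proof.
by move=> le; apply: (@multipliable1X _ _ (fun=> -1) e) => // k; rewrite mulrN1.
Qed.

Lemma euler0 : euler 0%N = 1. Proof. exact: iprod0. Qed.

Lemma V_euler t : (0 < t)%N -> V t euler = iprod (fun i => 1 - X ^+ (t * i.+1)).
Proof.
move=> t0; rewrite /euler V_iprod //; last exact: multipliable_1BX.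
apply: eq_iprod => i.
by rewrite rmorphB rmorph1 rmorphXn /= V_X // exprM.
Qed.

Lemma coef_V0 t (F : fps T) : V t F 0%N = F 0%N.
Proof. by rewrite /= dvdn0 div0n. Qed.

Lemma agree_cancel n (F G H : fps T) : F 0%N = 1 -> agree n (F * G) (F * H) -> agree n G H.
Proof.
case/fps_unit=> F' F'K e; rewrite -[G]mul1r -[H]mul1r -F'K [F * F']mulrC -!mulrA.
exact: agreeM.
Qed.

(** A Gaussian binomial with both lower parts large tends to the inverse of the Euler product. *)
Lemma gbin_agree t n k d : (0 < t)%N -> (n <= k)%N -> (n <= d)%N ->
  agree n (gbin (X ^+ t) (k + d) k * V t euler) 1.
Proof.
move=> t0 nk nd; pose E := V t euler.
have eP m : (n <= m)%N -> agree n E (qpoch (X ^+ t) m).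
  move=> le; rewrite /E V_euler //.
  apply: agree_trans (agree_le (leqW le) (iprod_agree _)) _.
    by apply: multipliable_1BX => i; rewrite leq_pmull.
  by move=> i _; congr fps_coef; apply: eq_bigr => j _; rewrite exprM.
apply: (@agree_cancel _ E); first by rewrite /E coef_V0 euler0.
rewrite mulr1; apply: agree_trans (agree_sym (eP (k + d)%N _));
  last exact: leq_trans (leq_addr _ _).
rewrite -gbin_qpoch mulrCA -mulrA; apply: agreeM => //.
by apply: agreeM; apply: eP.
Qed.

(* The factor 1 + b is kept apart because its constant term need not be 1 when r = 0. *)
Lemma triple_product r s (al be a b : fps T) : (0 < s)%N -> al * be = 1 ->
  a = X ^+ s * al -> b = X ^+ r * be -> let t := (r + s)%N in
  iprod (fun i => 1 + a * X ^+ (t * i))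
    * ((1 + b) * iprod (fun i => 1 + b * X ^+ (t * i.+1))) * V t euler =
  ssum (fun j => a ^+ j * X ^+ (t * 'C(j, 2)))
  + ssum (fun j => b ^+ j.+1 * X ^+ (t * 'C(j.+1, 2))).
Proof.
move=> s0 albe ea eb t; have t0 : (0 < t)%N by rewrite addn_gt0 s0 orbT.
have abQ : a * b = X ^+ t.
  by rewrite ea eb mulrACA albe mulr1 -exprD addnC.
have sa : summable (fun j => a ^+ j * X ^+ (t * 'C(j, 2))).
  by move=> j; rewrite ea exprMn -exprM -mulrA; apply: agreeMX; rewrite leq_pmull.
have Cj j : (j <= 'C(j.+1, 2))%N by rewrite binS bin1 leq_addl.
have sb : summable (fun j => b ^+ j.+1 * X ^+ (t * 'C(j.+1, 2))).
  move=> j; rewrite mulrC; apply: agreeMX; apply: leq_trans (Cj j) _.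
  by rewrite leq_pmull.
have ma : multipliable (fun i => 1 + a * X ^+ (t * i)).
  apply: (@multipliable1X _ _ (fun=> al) (fun i => s + t * i)%N) => k; first nia.
  by rewrite ea exprD; congr (_ + _); ring.
have mb : multipliable (fun i => 1 + b * X ^+ (t * i.+1)).
  apply: (@multipliable1X _ _ (fun=> be) (fun i => r + t * i.+1)%N) => k; first nia.
  by rewrite eb exprD; congr (_ + _); ring.
(* With N > 2n, an index k within n of either end lies at least n away from the centre, where the
   summand vanishes to order n; for all other k both lower parts of the binomial are at least n and
   [gbin_agree] applies. *)
apply: agreeP => n; pose N := (2 * n).+1.
apply: (@agree_trans _ n _ (\prod_(i < N) (1 + a * X ^+ t ^+ i)
   * \prod_(i < N.+1) (1 + b * X ^+ t ^+ i) * V t euler)).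
  have nN : (n <= N.+1)%N by rewrite /N; lia.
  apply: agreeM => //; apply: agreeM.
    apply: agree_trans (agree_le nN (iprod_agree ma)) _.
    by move=> i _; congr fps_coef; apply: eq_bigr => j _; rewrite exprM.
  rewrite big_ord_recl expr0 mulr1; apply: agreeM => //.
  apply: agree_trans (agree_le nN (iprod_agree mb)) _.
  by move=> i _; congr fps_coef; apply: eq_bigr => j _; rewrite exprM.
rewrite (finite_jtp _ _ abQ) mulr_suml.
apply: (@agree_trans _ n _ (\sum_(k < (N + N.+1).+1) jtp_term (X ^+ t) a b N.+1 k)).
  apply: agree_sum => k _; have := ltn_ord k; rewrite ltnS => lek.
  case: (boolP ((n <= k) && (n <= N + N.+1 - k))%N) => [/andP[l1 l2]|].
    rewrite mulrAC -[X in agree _ _ X]mul1r; apply: agreeM => //.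
    by rewrite -{1}(subnKC lek); apply: gbin_agree.
  move=> far; suff j0 : agree n (jtp_term (X ^+ t) a b N.+1 k) 0.
    by apply: agree_trans (agree_sym j0); rewrite mulrAC; apply: agreeMl.
  rewrite /jtp_term -!exprM; case: leqP => le.
    have -> : (N.+1 - k = (N.+1 - k).-1.+1)%N by lia.
    by apply: (agree_le _ (sb (N.+1 - k).-1)); lia.
  by apply: (agree_le _ (sa (k - N.+1)%N)); lia.
have nN : (n <= N.+1)%N by rewrite /N; lia.
apply/agree_sym/(agree_trans (agreeD (agree_le nN (ssum_agree sa))
  (agree_le nN (ssum_agree sb))))/agree_sym.
have -> : (N + N.+1).+1 = (N.+1 + N.+1)%N by lia.
rewrite addrC big_split_ord /=.
rewrite (reindex_inj rev_ord_inj) /=; apply: agreeD => i _; congr fps_coef;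
  apply: eq_bigr => j _.
  rewrite /jtp_term; have lt := ltn_ord j; rewrite leqNgt ifN; last by rewrite negbK; lia.
  have -> : (N.+1 - (N.+1 - j.+1) = j.+1)%N by lia.
  by rewrite exprM.
by rewrite /jtp_term leq_addr addKn exprM.
Qed.

End TripleProduct.

(** The part of the Euler product with exponents congruent to c + 1 modulo m. Splitting every
    [V j euler] into such atoms turns product identities into monomial identities. *)
HB.lock Definition cprod (T : comNzRingType) m c : fps T :=
  iprod (fun i => 1 - fps_X ^+ (m * i + c).+1).

(** * Theta series, their products and 3-dissection, and Jacobi's identity *)

Section Theta.
Variable T : comNzRingType.
Local Notation X := (@fps_X T).
Local Notation euler := (@euler T).

Lemma iprod_recl (f : nat -> fps T) : multipliable f ->
  iprod f = f 0%N * iprod (fun k => f k.+1).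
Proof.
move=> sf; apply: agreeP => n.
apply: (agree_trans (G := \prod_(k < n.+1) f k)).
  by apply: agree_le (iprod_agree sf); lia.
rewrite big_ord_recl; apply: agreeM => //; apply: agree_sym.
apply: agree_le (leqnSn n) (iprod_agree _) => k.
by apply: agree_le (sf _); lia.
Qed.

(* half of a theta series: adding htheta (t - s) t and removing the common term 1
   yields the sum over all integers j *)
Definition htheta s t : fps T := ssum (fun j => (-1) ^+ j * X ^+ (s * j + t * 'C(j, 2))).

Lemma summable_htheta (c : nat -> fps T) s t : (0 < s)%N ->
  summable (fun j => c j * X ^+ (s * j + t * 'C(j, 2))).
Proof. by move=> s0 k; rewrite mulrC; apply: agreeMX; nia. Qed.

Lemma triple_product_theta r s : (0 < r)%N -> (0 < s)%N ->
  iprod (fun i => 1 - X ^+ (s + (r + s) * i)) *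
  iprod (fun i => 1 - X ^+ (r + (r + s) * i)) * V (r + s) euler =
  htheta s (r + s) + htheta r (r + s) - 1.
Proof.
move=> r0 s0.
have := @triple_product T r s (-1) (-1) (- X ^+ s) (- X ^+ r) s0 _ _ _.
rewrite mulrNN mulr1 !mulrN1 => /(_ erefl erefl erefl) /=; set t := (r + s)%N => e.
have f0 : multipliable (fun i => 1 - X ^+ (r + t * i)).
  by apply: multipliable_1BX => k; nia.
have -> : htheta r t = 1 + ssum (fun j => (- X ^+ r) ^+ j.+1 * X ^+ (t * 'C(j.+1, 2))).
  rewrite /htheta ssum_recl; last exact: summable_htheta.
  rewrite bin0n !muln0 !expr0 mulr1; congr (1 + _); apply: eq_ssum => j.
  by rewrite [(- X ^+ r) ^+ _]exprNn -exprM exprD mulrA.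
have -> : htheta s t = ssum (fun j => (- X ^+ s) ^+ j * X ^+ (t * 'C(j, 2))).
  by apply: eq_ssum => j; rewrite [(- X ^+ s) ^+ _]exprNn -exprM exprD mulrA.
rewrite addrCA addrAC subrr add0r -e; congr (_ * _ * _).
  by apply: eq_iprod => i; rewrite mulNr exprD.
rewrite (iprod_recl f0) muln0 addn0; congr (_ * _).
by apply: eq_iprod => i; rewrite mulNr exprD.
Qed.

Definition theta : fps T := 2%:R * htheta 1 2 - 1.
(** The sum of (-1)^j q^(3j^2+2j) over all integers j, as two halves sharing the term j = 0. *)
Definition omega : fps T := htheta 5 6 + htheta 1 6 - 1.

Local Notation P := (@cprod T).

Lemma cprodE m c (f : nat -> fps T) :
  (forall i, f i = 1 - X ^+ (m * i + c).+1) -> iprod f = P m c.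
Proof. by move=> e; rewrite cprod.unlock; apply: eq_iprod. Qed.

Lemma euler_dissect k : (0 < k)%N -> euler = \prod_(c < k) P k c.
Proof.
move=> k0; rewrite /euler (iprod_dissect k0); last exact: multipliable_1BX.
by apply: eq_bigr => c _; apply: cprodE.
Qed.

Lemma V_euler_dissect j k : (0 < j)%N -> (0 < k)%N ->
  V j euler = \prod_(c < k) P (j * k) (j * c.+1).-1.
Proof.
move=> j0 k0; rewrite V_euler // (iprod_dissect k0); last first.
  by apply: multipliable_1BX => i; rewrite leq_pmull.
apply: eq_bigr => c _; apply: cprodE => i; congr (1 - X ^+ _); nia.
Qed.

Lemma theta_euler : theta * V 2 euler = euler ^+ 2.
Proof.
have -> : theta = htheta 1 2 + htheta 1 2 - 1 by rewrite /theta mulr_natl mulr2n.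
rewrite -(@triple_product_theta 1 1) // (@cprodE 2 0) => [|i];
  last by congr (1 - X ^+ _); lia.
have -> : V (1 + 1) euler = P 2 1.
  by rewrite (V_euler_dissect (k := 1)) // big_ord1.
have -> : euler = P 2 0 * P 2 1.
  by rewrite (euler_dissect (k := 2)) // !big_ord_recl big_ord0 mulr1.
by rewrite exprMn -mulrA.
Qed.

Lemma omega_euler : omega * V 2 euler * V 3 euler = euler * V 6 euler ^+ 2.
Proof.
rewrite /omega -(@triple_product_theta 1 5) //.
rewrite (@cprodE 6 4) => [|i]; last by congr (1 - X ^+ _); lia.
rewrite (@cprodE 6 0) => [|i]; last by congr (1 - X ^+ _); lia.
have -> : V 6 euler = P 6 5.
  by rewrite (V_euler_dissect (k := 1)) // big_ord1.
have -> : V 2 euler = P 6 1 * (P 6 3 * P 6 5).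
  by rewrite (V_euler_dissect (k := 3)) // !big_ord_recl big_ord0 mulr1.
have -> : V 3 euler = P 6 2 * P 6 5.
  by rewrite (V_euler_dissect (k := 2)) // !big_ord_recl big_ord0 mulr1.
have -> : euler = P 6 0 * (P 6 1 * (P 6 2 * (P 6 3 * (P 6 4 * P 6 5)))).
  by rewrite (euler_dissect (k := 6)) // !big_ord_recl big_ord0 mulr1.
move: (P 6 0) (P 6 1) (P 6 2) (P 6 3) (P 6 4) (P 6 5) => *; ring.
Qed.

Lemma euler_pentagonal : euler = htheta 2 3 + htheta 1 3 - 1.
Proof.
rewrite -(@triple_product_theta 1 2) //.
rewrite (@cprodE 3 1) => [|i]; last by congr (1 - X ^+ _); lia.
rewrite (@cprodE 3 0) => [|i]; last by congr (1 - X ^+ _); lia.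
rewrite (V_euler_dissect (k := 1)) // big_ord1.
rewrite (euler_dissect (k := 3)) // !big_ord_recl big_ord0 mulr1.
by rewrite mulrA [P 3 1 * _]mulrC.
Qed.

Lemma V_htheta k s t : (0 < k)%N -> (0 < s)%N ->
  V k (htheta s t) = ssum (fun j => (-1) ^+ j * X ^+ (k * (s * j + t * 'C(j, 2)))).
Proof.
move=> k0 s0; rewrite /htheta V_ssum //; last exact: summable_htheta.
apply: eq_ssum => j.
by rewrite rmorphM /= !rmorphXn /= rmorphN1 V_X // exprM.
Qed.

Lemma bin2D j k : 'C(j + k, 2) = ('C(j, 2) + 'C(k, 2) + j * k)%N.
Proof.
elim: k => [|k IH]; first by rewrite addn0 muln0 !addn0.
by rewrite addnS !binS IH !bin1; lia.
Qed.

Lemma bin2_sqr j : (2 * 'C(j, 2) + j = j * j)%N.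
Proof. by elim: j => // j IH; rewrite binS bin1; lia. Qed.

Lemma bin2M3 j : 'C(3 * j, 2) = (9 * 'C(j, 2) + 3 * j)%N.
Proof. have := bin2_sqr j; have := bin2_sqr (3 * j); lia. Qed.

Lemma ssumN (f : nat -> fps T) : - ssum f = ssum (fun j => - f j).
Proof. by apply: fpsP => n /=; rewrite sumrN. Qed.

Lemma ssum_dissect3 (f : nat -> fps T) : summable f ->
  ssum f = ssum (fun j => f (3 * j)%N) + ssum (fun j => f (3 * j + 1)%N)
           + ssum (fun j => f (3 * j + 2)%N).
Proof.
move=> sf; rewrite (ssum_dissect (m := 3)) // !big_ord_recl big_ord0 addr0 addrA.
congr (_ + _ + _); apply: eq_ssum => j; congr f; exact: addn0.
Qed.

Lemma signM3 j : (-1) ^+ (3 * j) = (-1) ^+ j :> fps T.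
Proof. by rewrite exprM; congr (_ ^+ j); ring. Qed.

(** Squares of 3j give [V 9 theta]. Those of 3j + 1 and 3(j+1) - 1 are 1 + 3(3j^2 + 2j) and 1 +
    3(3(j+1)^2 - 2(j+1)), the two halves of [omega]; so half of [theta] already produces all of
    [omega], whence the 2. *)
Lemma theta_dissect : theta = V 9 theta - 2%:R * fps_X * V 3 omega.
Proof.
suff e : htheta 1 2 = V 9 (htheta 1 2) - X * V 3 omega.
  have -> : V 9 theta = 2%:R * V 9 (htheta 1 2) - 1.
    by rewrite /theta rmorphB rmorph1 rmorphM rmorph_nat.
  by rewrite {1}/theta {1}e; ring.
have e5 : summable (fun j => (-1) ^+ j * X ^+ (3 * (5 * j + 6 * 'C(j, 2)))).
  by move=> j; rewrite mulrC; apply: agreeMX; lia.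
have e1 : summable (fun j => (-1) ^+ j * X ^+ (3 * (1 * j + 6 * 'C(j, 2)))).
  by move=> j; rewrite mulrC; apply: agreeMX; lia.
rewrite {1}/htheta ssum_dissect3; last exact: summable_htheta.
rewrite /omega rmorphB rmorphD rmorph1 /= !V_htheta //.
rewrite [X in _ + X - 1]ssum_recl // muln0 bin0n !muln0 !expr0 mulr1.
rewrite [1 + _ in RHS]addrC addrA addrK mulrDr opprD !ssumMl //; last first.
  by move=> j; apply: agree_le (e1 j.+1).
rewrite addrA; congr (_ + _ + _).
- apply: eq_ssum => j; rewrite bin2M3 signM3; congr (_ * _ ^+ _); lia.
- rewrite ssumN; apply: eq_ssum => j; rewrite exprD signM3 expr1 bin2D bin2M3.
  have -> : (1 * (3 * j + 1) + 2 * (9 * 'C(j, 2) + 3 * j + 'C(1, 2) + 3 * j * 1) =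
    (3 * (5 * j + 6 * 'C(j, 2))).+1)%N by rewrite (_ : 'C(1, 2) = 0)%N //; lia.
  by rewrite exprS; ring.
rewrite ssumN; apply: eq_ssum => j.
rewrite exprD signM3 sqrrN expr1n mulr1 bin2D bin2M3 binS bin1.
rewrite [(-1) ^+ j.+1]exprS.
have -> : (1 * (3 * j + 2) + 2 * (9 * 'C(j, 2) + 3 * j + 'C(2, 2) + 3 * j * 2) =
    (3 * (1 * j.+1 + 6 * ('C(j, 2) + j))).+1)%N by rewrite (_ : 'C(2, 2) = 1)%N //; lia.
by rewrite [X ^+ _.+1]exprS [in RHS]binS bin1; ring.
Qed.

(* Jacobi's identity is the derivative of the triple product at z = 1; here z = 1 + eps
   with eps the variable of an inner power series ring, and the derivative is
   the coefficient of eps. *)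
Definition jacobi_series : fps T :=
  ssum (fun j => (-1) ^+ j * (2 * j + 1)%:R * X ^+ 'C(j.+1, 2)).

(** The outer variable is q and the coefficients are series in eps; this extracts the coefficient of
    eps^i. At i = 0 it is multiplicative, at i = 1 it obeys the Leibniz rule. *)
Definition inner (i : nat) (F : fps (fps T)) : fps T := Fps (fun n => F n i).

Lemma innerD i : {morph inner i : F G / F + G}.
Proof. by move=> F G; apply: fpsP. Qed.
Lemma inner_0 i : inner i 0 = 0.
Proof. by apply: fpsP. Qed.

Lemma inner0M : {morph inner 0 : F G / F * G}.
Proof.
move=> F G; apply: fpsP => n /=; rewrite !fcoefM fcoef_sum.
by apply: eq_bigr => i _; rewrite fcoefM0.
Qed.

Lemma inner1M F G : inner 1 (F * G) = inner 0 F * inner 1 G + inner 1 F * inner 0 G.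
Proof.
apply: fpsP => n; rewrite fcoefD !fcoefM -big_split /= fcoefM fcoef_sum.
by apply: eq_bigr => i _; rewrite fcoefM1.
Qed.

Lemma inner_1 i : inner i 1 = if i == 0 then 1 else 0.
Proof.
by apply: fpsP => -[|n]; rewrite /= ?fcoef1; case: (i).
Qed.

Lemma inner_ssum i (f : nat -> fps (fps T)) :
  inner i (ssum f) = ssum (fun k => inner i (f k)).
Proof.
by apply: fpsP => n /=; rewrite -!(big_morph (inner i) (innerD i) (inner_0 i)).
Qed.

Lemma inner0_iprod (f : nat -> fps (fps T)) :
  inner 0 (iprod f) = iprod (fun k => inner 0 (f k)).
Proof.
by apply: fpsP => n /=; rewrite -!(big_morph (inner 0) inner0M (inner_1 0)).
Qed.

Lemma inner_Xn_const i n (c : fps T) :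
  inner i (fps_X ^+ n * fps_const c) = fps_const (c i) * X ^+ n.
Proof.
apply: fpsP => m; rewrite fcoefCM fcoefXn.
transitivity ((if (m < n)%N then 0 else fps_const c (m - n)%N) i).
  by rewrite -fcoefXnM.
case: ltngtP => [_|lt|->]; rewrite ?mulr0 // ?mulr1 /=.
  by rewrite subn_eq0 leqNgt lt.
by rewrite subnn.
Qed.

Lemma inner_const i (c : fps T) : inner i (fps_const c) = fps_const (c i).
Proof. by apply: fpsP => -[]. Qed.

Lemma euler_cube : euler ^+ 3 = jacobi_series.
Proof.
pose z : fps T := 1 + fps_X; have [|z' zz'] := @fps_unit _ z.
  by rewrite fcoefD /= addr0.
have z0 : z 0%N = 1 by rewrite fcoefD /= addr0.
have z1 : z 1%N = 1 by rewrite fcoefD /= add0r.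
have z'0 : z' 0%N = 1.
  by have := congr1 (fun F : fps T => F 0%N) zz'; rewrite fcoefM0 z0 mul1r.
have z'1 : z' 1%N = -1.
  have := congr1 (fun F : fps T => F 1%N) zz'.
  rewrite fcoefM1 z0 z1 z'0 !mul1r /= => e; apply: (addIr 1); by rewrite e addNr.
have pow0 (F : fps T) j : F 0%N = 1 -> (F ^+ j) 0%N = 1.
  by move=> F0; elim: j => // j IH; rewrite exprS fcoefM0 F0 IH mulr1.
have pow1 (F : fps T) j : F 0%N = 1 -> (F ^+ j) 1%N = F 1%N *+ j.
  move=> F0; elim: j => // j IH.
  by rewrite exprS fcoefM1 F0 IH pow0 // mul1r mulr1 mulrSr.
have constM (x y : fps T) : fps_const x * fps_const y = fps_const (x * y).
  by apply: fpsP => n; rewrite fcoefCM /=; case: ifP; rewrite ?mulr0.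
have const1 : fps_const (1 : fps T) = 1 by apply: fpsP => -[].
have constX (x : fps T) j : fps_const x ^+ j = fps_const (x ^+ j).
  by elim: j => [|j IH]; rewrite ?const1 // exprS IH constM -exprS.
have constB (x : T) : 1 + fps_const (- x) = fps_const (1 - x) :> fps T.
  by apply: fpsP => -[|n] //=; rewrite addr0.
have signE (F : fps T) j i : ((-1) ^+ j * F) i = (-1) ^+ j * F i.
  by rewrite -signr_odd -[in RHS]signr_odd; case: odd; rewrite ?mulN1r ?mul1r.
have powN (F : fps T) j : F 0%N = 1 -> ((- F) ^+ j) 1%N = (-1) ^+ j * (F 1%N *+ j).
  by move=> F0; rewrite [(- F) ^+ j]exprNn signE pow1.
have constS j k : fps_const ((-1) ^+ j * k%:R) = (-1) ^+ j * k%:R :> fps T.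
  apply: fpsP => n; rewrite signE fcoefMn; case: n => //= n.
  by rewrite mul0rn mulr0.
have innerX n : inner 0 (fps_X ^+ n) = X ^+ n.
  rewrite -[fps_X ^+ n]mulr1 -const1 inner_Xn_const fcoef1 -[RHS]mul1r.
  by congr (_ * _); apply: fpsP => -[].
have albe : fps_const (- z) * fps_const (- z') = 1.
  by rewrite constM mulrNN zz' const1.
have := @triple_product _ 0 1 _ _ _ _ isT albe erefl erefl.
rewrite /= V_id expr1 expr0 mul1r.
move/(congr1 (inner 1)); rewrite !inner1M !inner0M [inner 1 (ssum _ + _)]innerD.
(* The factor 1 - 1/z vanishes at eps = 0 with derivative 1, so the Leibniz rule leaves the three
   other factors at eps = 0, each equal to [euler]. *)
have -> : inner 0 (1 + fps_const (- z')) = 0.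
  by rewrite innerD inner_1 inner_const /= ?fcoefN z'0 constB subrr; apply: fpsP => -[].
have -> : inner 1 (1 + fps_const (- z')) = 1.
  by rewrite innerD inner_1 inner_const /= ?fcoefN z'1 opprK add0r; apply: fpsP => -[].
rewrite !(mul0r, mulr0, mul1r, addr0, add0r).
rewrite !inner0_iprod.
have -> : iprod (fun k => inner 0 (1 + fps_X * fps_const (- z) * fps_X ^+ (1 * k))) = euler.
  apply: eq_iprod => i; rewrite innerD inner_1 /= mulrAC -exprS mul1n inner_Xn_const.
  by rewrite ?fcoefN z0; congr (_ + _); apply: fpsP => n; rewrite fcoefCM mulN1r.
have -> : iprod (fun k => inner 0 (1 + fps_const (- z') * fps_X ^+ (1 * k.+1))) = euler.
  apply: eq_iprod => i; rewrite innerD inner_1 /= mulrC mul1n inner_Xn_const.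
  by rewrite ?fcoefN z'0; congr (_ + _); apply: fpsP => n; rewrite fcoefCM mulN1r.
have -> : iprod (fun k => inner 0 (1 - fps_X ^+ k.+1)) = euler.
  apply: eq_iprod => i; rewrite innerD inner_1 /=; congr (_ + _).
  by rewrite -innerX; apply: fpsP.
(* The terms in a^j and b^(j+1) share the exponent j(j+1)/2 and contribute j and j + 1 with the same
   sign, hence the weight 2j + 1. *)
rewrite -!expr2 -exprSr => ->; rewrite !inner_ssum ssumD; apply: eq_ssum => j.
rewrite exprMn mulrAC -exprD !constX inner_Xn_const powN // z1 constS.
rewrite [fps_const _ * _]mulrC inner_Xn_const powN // z'1 mulNrn mulrN exprS.
rewrite mulN1r mulNr opprK constS.
by rewrite !mul1n binS bin1 [(j + _)%N]addnC natrD natrM mulrSr; ring.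
Qed.

End Theta.

(** * Congruences between integral power series *)

Section Congruence.
Implicit Types (F G H : fps int) (m n k : nat).

(** An explicit witness H lets congruences be closed by [ring]; [congP] is the coefficientwise
    form. *)
Definition cong m F G := exists H, F = G + m%:R * H.

Lemma congP m F G : cong m F G <-> forall n, (m%:Z %| F n - G n)%Z.
Proof.
have mH H n : (m%:R * H) n = m%:Z * H n.
  by rewrite mulr_natl fcoefMn -mulr_natl natz.
split=> [[H ->] n|d].
  by rewrite fcoefD addrC addKr mH dvdz_mulr.
exists (Fps (fun n => (F n - G n) %/ m%:Z)%Z); apply: fpsP => n.
by rewrite fcoefD mH /= mulrC divzK // addrC subrK.
Qed.

Lemma cong_refl m F : cong m F F.
Proof. by exists 0; rewrite mulr0 addr0. Qed.
Lemma cong_sym m F G : cong m F G -> cong m G F.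
Proof. by case=> H ->; exists (- H); ring. Qed.
Lemma cong_trans m G F H : cong m F G -> cong m G H -> cong m F H.
Proof. by case=> A -> [B ->]; exists (A + B); ring. Qed.
Lemma congD m F G F' G' : cong m F F' -> cong m G G' -> cong m (F + G) (F' + G').
Proof. by case=> A -> [B ->]; exists (A + B); ring. Qed.
Lemma congM m F G F' G' : cong m F F' -> cong m G G' -> cong m (F * G) (F' * G').
Proof. by case=> A -> [B ->]; exists (A * G' + B * F' + m%:R * A * B); ring. Qed.
Lemma congMl m F G G' : cong m G G' -> cong m (F * G) (F * G').
Proof. by apply: congM; apply: cong_refl. Qed.
Lemma congMr m F F' G : cong m F F' -> cong m (F * G) (F' * G).
Proof. by move=> e; apply: congM => //; apply: cong_refl. Qed.
Lemma congX m F G k : cong m F G -> cong m (F ^+ k) (G ^+ k).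
Proof.
move=> e; elim: k => [|k IH]; first exact: cong_refl.
by rewrite !exprS; apply: congM.
Qed.
Lemma cong_scale d m F G : cong m F G -> cong (d * m) (d%:R * F) (d%:R * G).
Proof. by case=> H ->; exists H; rewrite natrM; ring. Qed.
Lemma congU m k r F G : cong m F G -> cong m (U k r F) (U k r G).
Proof. by move/congP => e; apply/congP => n; apply: e. Qed.
Lemma congV m k F G : cong m F G -> cong m (V k F) (V k G).
Proof.
by case=> H ->; exists (V k H); rewrite rmorphD rmorphM rmorph_nat.
Qed.
Lemma cong_ssum m f g : (forall j, cong m (f j) (g j)) -> cong m (ssum f) (ssum g).
Proof.
move=> e; apply/congP => n.
have E (h : nat -> fps int) : ssum h n = \sum_(k < n.+1) h k n by rewrite -fcoef_sum.
rewrite !E -sumrB.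
by apply: rpred_sum => j _; apply: (congP _ _ _).1.
Qed.
Lemma cong_unit m F G H : F 0%N = 1 -> cong m (F * G) (F * H) -> cong m G H.
Proof.
case/fps_unit=> F' F'K /(congMl F'); by rewrite !mulrA [F' * F]mulrC F'K !mul1r.
Qed.

(** Squaring is additive modulo 2 and c^2 = c modulo 2 for an integer c, so a truncation of F is
    treated one monomial at a time. *)
Lemma frobenius F : cong 2 (F ^+ 2) (V 2 F).
Proof.
apply/congP => n; have e := @agree_expand _ n.+1 F.
rewrite expr2 (agreeM e e) // (agree_V _ e) //.
move: n.+1 {e} => N; move: n; apply/(congP _ _ _).1; elim: N => [|N IH].
  by rewrite big_ord0 rmorph0 mulr0; apply: cong_refl.
rewrite big_ord_recr /= rmorphD /=; set A := \sum_(i < N) _ in IH *.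
set c := F N.
have cc : cong 2 (fps_const c * fps_const c) (fps_const c).
  apply/congP => -[|n]; rewrite fcoefCM /=; last by rewrite mulr0 subrr.
  have [k [->|->]] : exists k : int, c = k * 2 \/ c = k * 2 + 1.
  - exists (c %/ 2)%Z; lia.
  - by apply/dvdzP; exists (2 * k * k - k); ring.
  by apply/dvdzP; exists (2 * k * k + k); ring.
rewrite V_const // rmorphXn /= V_X // -exprM.
apply: (@cong_trans _ (A * A + (fps_const c * fps_const c) * fps_X ^+ (2 * N))).
  exists (A * fps_const c * fps_X ^+ N); rewrite mul2n -addnn exprD; ring.
by apply: congD => //; apply: congMr.
Qed.

End Congruence.

(** * Identities and parities for the 3-dissections *)

Section ThetaIdentities.
Local Notation X := (@fps_X int).
Local Notation euler := (euler int).
Local Notation theta := (theta int).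
Local Notation omega := (omega int).
Local Notation jacobi := (jacobi_series int).

Lemma ssum_dissect2 (f : nat -> fps int) : summable f ->
  ssum f = ssum (fun j => f (2 * j)%N) + ssum (fun j => f (2 * j + 1)%N).
Proof.
move=> sf; rewrite (ssum_dissect (m := 2)) // !big_ord_recl big_ord0 addr0.
congr (_ + _); apply: eq_ssum => j; congr f; exact: addn0.
Qed.

Lemma bin2M2 j : 'C(2 * j, 2) = (4 * 'C(j, 2) + j)%N.
Proof. have := bin2_sqr j; have := bin2_sqr (2 * j); lia. Qed.

Lemma signM2 j : (-1) ^+ (2 * j) = 1 :> fps int.
Proof. by rewrite exprM sqrrN !expr1n. Qed.

(* the exponents j(j+1)/2 with j = 0 or 2 mod 3 are multiples of 3, and dividing them
   by 3 yields the pentagonal numbers *)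
Definition jacobi0 : fps int :=
  ssum (fun j => (-1) ^+ j * (6 * j + 1)%:R * X ^+ (2 * j + 3 * 'C(j, 2)))
  + ssum (fun j => (-1) ^+ j * (6 * j + 5)%:R * X ^+ (1 * j.+1 + 3 * 'C(j.+1, 2))).

Lemma summableXn (c : nat -> fps int) (e : nat -> nat) : (forall k, k <= e k)%N ->
  summable (fun j => c j * X ^+ e j).
Proof. by move=> le k; rewrite mulrC; apply/agreeMX/le. Qed.

Lemma V_ssumX k (c : nat -> nat) (e : nat -> nat) : (0 < k)%N ->
  (forall j, j <= e j)%N ->
  V k (ssum (fun j => (-1) ^+ j * (c j)%:R * X ^+ e j)) =
  ssum (fun j => (-1) ^+ j * (c j)%:R * X ^+ (k * e j)).
Proof.
move=> k0 le; rewrite V_ssum //; last exact: summableXn.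
apply: eq_ssum => j; rewrite !rmorphM /= rmorph_nat !rmorphXn /= rmorphN1 V_X //.
by rewrite exprM.
Qed.

(** No triangular number is 2 modulo 3, and those that are 1 have index 3j + 1, where the weight is
    3(2j + 1) and the exponent 1 + 9j(j+1)/2. *)
Lemma jacobi_dissect : jacobi = V 3 jacobi0 - 3%:R * X * V 9 jacobi.
Proof.
have C j : (j <= 'C(j.+1, 2))%N by rewrite binS bin1 leq_addl.
rewrite {1}/jacobi_series ssum_dissect3; last exact: summableXn.
rewrite /jacobi0 rmorphD /=.
rewrite (@V_ssumX 3 (fun j => 6 * j + 1)%N (fun j => 2 * j + 3 * 'C(j, 2))%N) //;
  last by lia.
rewrite (@V_ssumX 3 (fun j => 6 * j + 5)%N (fun j => 1 * j.+1 + 3 * 'C(j.+1, 2))%N) //;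
  last by lia.
rewrite /jacobi_series (@V_ssumX 9 (fun j => 2 * j + 1)%N (fun j => 'C(j.+1, 2))) //.
rewrite -mulNr ssumMl; last first.
  by apply: summableXn => j; have := C j; lia.
rewrite addrAC; congr (_ + _ + _); apply: eq_ssum => j.
- rewrite signM3; congr (_ * _%:R * _ ^+ _); first by lia.
  by rewrite binS bin1 bin2M3; lia.
- rewrite exprD signM3 sqrrN expr1n mulr1; congr (_ * _%:R * _ ^+ _); first by lia.
  by rewrite !binS !bin1 bin2D bin2M3 (_ : 'C(2, 2) = 1%N) //; lia.
rewrite exprD signM3 expr1.
have -> : ('C((3 * j + 1).+1, 2) = (9 * 'C(j.+1, 2)).+1)%N.
  by rewrite !binS !bin1 bin2D bin2M3 (_ : 'C(1, 2) = 0%N) //; lia.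
have -> : (2 * (3 * j + 1) + 1 = 3 * (2 * j + 1))%N by lia.
by rewrite natrM [X ^+ _.+1]exprS; ring.
Qed.

(** The weights 6j + 1 and 6j + 5 are odd, so only the pentagonal exponents remain. *)
Lemma jacobi0_mod2 : cong 2 jacobi0 euler.
Proof.
rewrite euler_pentagonal /jacobi0 -addrA; apply: congD.
  apply: cong_ssum => j; exists ((-1) ^+ j * (3 * j)%:R * X ^+ (2 * j + 3 * 'C(j, 2))).
  by ring.
rewrite /htheta [in X in cong _ _ X]ssum_recl; last exact: summable_htheta.
rewrite muln0 bin0n muln0 !expr0 mulr1 addrAC subrr add0r.
apply: cong_ssum => j.
exists ((-1) ^+ j * (3 * j + 3)%:R * X ^+ (1 * j.+1 + 3 * 'C(j.+1, 2))).
by rewrite exprS; ring.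
Qed.

(** Odd exponents come from odd j = 2i + 1, where 3j^2 + 2j = 1 + 4(3(i+1)^2 - 2(i+1)): removing 1
    and halving leaves twice an exponent of [omega], and modulo 2 the signs do not matter. *)
Lemma omega_odd_mod2 : cong 2 (U 2 1 omega) (V 2 omega).
Proof.
(* Terms of even and odd index of [htheta s 6], with the exponents halved after removing the
   parity. *)
pose ev s := ssum (fun j => X ^+ ((s + 3) * j + 12 * 'C(j, 2))).
pose od s := ssum (fun j => - X ^+ ((s + 9) * j + s./2 + 12 * 'C(j, 2))).
have half s : odd s -> htheta int s 6 = V 2 (ev s) + X * V 2 (od s).
  move=> os; have os2 : (s = s./2 * 2 + 1)%N by lia.
  rewrite /htheta ssum_dissect2; last by apply: summable_htheta; lia.
  have sev : summable (fun j => X ^+ ((s + 3) * j + 12 * 'C(j, 2))).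
    by move=> j; rewrite -[X ^+ _]mulr1; apply: agreeMX; lia.
  have sod : summable (fun j => - X ^+ ((s + 9) * j + s./2 + 12 * 'C(j, 2))).
    by move=> j; rewrite -mulrN1; apply: agreeMX; lia.
  rewrite /ev /od !V_ssum // ssumMl; last first.
    by move=> j; rewrite -(rmorph0 (V 2)); apply: agree_V => //; apply: sod.
  congr (_ + _); apply: eq_ssum => j.
    rewrite signM2 mul1r rmorphXn /= V_X // -exprM bin2M2; congr (_ ^+ _); lia.
  rewrite exprD signM2 expr1 rmorphN rmorphXn /= V_X // -exprM bin2D bin2M2.
  rewrite mul1r mulN1r mulrN -exprS (_ : 'C(1, 2) = 0%N) //; congr (- _ ^+ _).
  by rewrite [in LHS]os2; lia.
have e : omega = V 2 (ev 5 + ev 1 - 1) + X * V 2 (od 5 + od 1).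
  by rewrite /omega !half // !(rmorphB, rmorphD, rmorph1) /=; ring.
rewrite {1}e; have [_ ->] := U2_eq (ev 5 + ev 1 - 1) (od 5 + od 1).
rewrite /omega rmorphB rmorphD rmorph1 /= !V_htheta // addrC -addrA.
apply: congD.
  apply: cong_ssum => j; rewrite -[(-1) ^+ j]signr_odd.
  have -> : ((1 + 9) * j + 1./2 + 12 * 'C(j, 2) = 2 * (5 * j + 6 * 'C(j, 2)))%N by lia.
  by case: odd; [exists 0|exists (- X ^+ (2 * (5 * j + 6 * 'C(j, 2))))]; ring.
rewrite [in X in cong _ _ X]ssum_recl; last by apply: summableXn; lia.
rewrite muln0 bin0n !muln0 !expr0 mulr1 addrAC subrr add0r.
apply: cong_ssum => j; rewrite binS bin1 -[(-1) ^+ j.+1]signr_odd.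
have -> : ((5 + 9) * j + 5./2 + 12 * 'C(j, 2) =
  2 * (1 * j.+1 + 6 * ('C(j, 2) + j)))%N by lia.
by case: odd; [exists 0|exists (- X ^+ (2 * (1 * j.+1 + 6 * ('C(j, 2) + j))))]; ring.
Qed.

(** For m prime to 3 the conjugates of 1 - q^m multiply to 1 - q^(3m), which is 1 - q^m again once
    q^3 is renamed q. *)
Lemma norm3_cprod c : (c < 2)%N -> norm3 (cprod int 3 c) = cprod int 3 c.
Proof.
move=> c2; rewrite cprod.unlock.
have m : multipliable (fun i => 1 - X ^+ (3 * i + c).+1).
  by apply: multipliable_1BX => k; lia.
have e : @norm3 int \o (fun i => 1 - X ^+ (3 * i + c).+1) =
  (fun i => 1 - X ^+ (3 * i + c).+1).
  apply: funext => i /=; case: c c2 {m} => [|[|c]] // _.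
    have := norm3_eq 1 (- X ^+ i) 0.
    rewrite rmorph1 rmorphN rmorphXn rmorph0 /= V_X // !(mulr0, addr0, subr0) -exprM.
    by rewrite addn0 [X ^+ (3 * i).+1]exprS -mulrN => ->; rewrite mulnC exprM; ring.
  have := norm3_eq 1 0 (- X ^+ i).
  rewrite rmorph1 rmorphN rmorphXn rmorph0 /= V_X // -exprM.
  have -> : X ^+ (3 * i + 1).+1 = X ^+ 2 * X ^+ (3 * i) by rewrite addn1 -addn2 addnC exprD.
  rewrite !(mulr0, addr0, mul0r, subr0) -mulrN => ->; rewrite mulnC exprM; ring.
by rewrite norm3_iprod ?e.
Qed.

(** The norm fixes the factors with exponent prime to 3 and cubes the rest, [V 3 euler], into
    [euler ^+ 3]. *)
Lemma norm3_euler : norm3 euler * V 3 euler = euler ^+ 4.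
Proof.
have e3 : V 3 euler = cprod int 3 2.
  by rewrite (V_euler_dissect _ (k := 1)) // big_ord1.
have e : euler = cprod int 3 0 * (cprod int 3 1 * cprod int 3 2).
  by rewrite [LHS](euler_dissect _ (k := 3)) // !big_ord_recl big_ord0 mulr1.
have -> : norm3 euler = cprod int 3 0 * (cprod int 3 1 * euler ^+ 3).
  by rewrite {1}e -e3 !norm3M !norm3_cprod // norm3_V3.
rewrite e3 [RHS]exprS; move: (euler ^+ 3) => u; rewrite e; ring.
Qed.

Local Notation f k := (V k euler).

Lemma V_euler0 k : f k 0%N = 1.
Proof. by rewrite coef_V0 euler0. Qed.

Lemma exp_coef0 (F : fps int) k : F 0%N = 1 -> (F ^+ k) 0%N = 1.
Proof. by move=> F0; elim: k => // k IH; rewrite exprS fcoefM0 F0 IH mulr1. Qed.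

Lemma theta_f3 : V 3 theta * f 6 = f 3 ^+ 2.
Proof. by rewrite -rmorphXn /= -theta_euler rmorphM /= V_comp. Qed.

Lemma norm3_theta : norm3 theta = V 3 theta ^+ 3 - 8%:R * X * omega ^+ 3.
Proof.
have e : theta = V 3 (V 3 theta) + X * V 3 (- (2%:R * omega)) + X ^+ 2 * V 3 0.
  by rewrite [LHS]theta_dissect V_comp // rmorphN rmorphM rmorph_nat rmorph0 /=; ring.
by rewrite [in LHS]e norm3_eq; ring.
Qed.

(** The norm of [theta] is computed twice: from its 3-dissection, and from theta f_2 = f_1^2 by
    multiplicativity. *)
Lemma theta_quartic :
  V 3 theta * (V 3 theta ^+ 3 - 8%:R * X * omega ^+ 3) = theta ^+ 4.
Proof.
rewrite -norm3_theta.
have t := theta_euler int; have t3 := theta_f3; have nE := norm3_euler.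
have nE2 : V 2 (norm3 euler) * f 6 = f 2 ^+ 4.
  by rewrite -rmorphXn /= -nE rmorphM /= V_comp.
have nt : norm3 theta * V 2 (norm3 euler) = norm3 euler ^+ 2.
  by rewrite -norm3_V2 -norm3M t expr2 norm3M.
apply: (@fps_lcancel _ (f 2 ^+ 4 * f 6)).
  by rewrite fcoefM0 exp_coef0 V_euler0 ?mulr1.
move: euler theta (f 6) (f 3) (f 2) (norm3 euler) (V 2 (norm3 euler)) (V 3 theta)
  (norm3 theta) t t3 nE nE2 nt => e th f6 f3 f2 ne ne2 a nth t t3 nE nE2 nt.
transitivity (nth * ne2 * f6 * (a * f6)); first by rewrite -nE2; ring.
rewrite nt t3; transitivity ((ne * f3) ^+ 2 * f6); first by ring.
rewrite nE; transitivity ((e ^+ 2) ^+ 4 * f6); first by ring.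
by rewrite -t; ring.
Qed.

(** A comparison of products; it trades omega^2 for theta functions both in the exact formula for
    the indices 3n + 2 and modulo 2. *)
Lemma omega_theta : f 2 * omega ^+ 2 * V 3 theta = f 6 ^+ 3 * theta.
Proof.
have t := theta_euler int; have t3 := theta_f3; have o := omega_euler int.
apply: (@fps_lcancel _ (f 2 * f 6)).
  by rewrite fcoefM0 !V_euler0 mulr1.
move: omega euler theta (f 6) (f 3) (f 2) (V 3 theta) t t3 o => w e th f6 f3 f2 a t t3 o.
transitivity (w ^+ 2 * f2 ^+ 2 * (a * f6)); first by ring.
rewrite t3; transitivity ((w * f2 * f3) ^+ 2); first by ring.
rewrite o; transitivity (e ^+ 2 * f6 ^+ 4); first by ring.
by rewrite -t; ring.
Qed.

Lemma theta0 : theta 0%N = 1.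
Proof.
have := congr1 (fun F : fps int => F 0%N) (theta_euler int).
by rewrite fcoefM0 V_euler0 mulr1 => ->; rewrite exp_coef0 ?euler0.
Qed.

(** * The subsequences of indices 9n+2 *)

Local Notation a := (V 3 theta).
Local Notation S := (htheta int 1 2 - 1).
Local Notation K := (f 2 ^+ 3).

Lemma theta_1D : theta = 1 + 2%:R * S.
Proof. by rewrite /theta; ring. Qed.

(** ((1 + 2S)^4 - 1)/8 expanded, so that integrality is visible. *)
Definition theta8 : fps int := S + 3%:R * S ^+ 2 + 4%:R * S ^+ 3 + 2%:R * S ^+ 4.
Local Notation Y := theta8.

Lemma theta_pow4 : theta ^+ 4 = 1 + 8%:R * Y.
Proof. by rewrite theta_1D /theta8; move: S => s; ring. Qed.

Lemma theta3_1D : a = 1 + 2%:R * V 3 S.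
Proof. by rewrite {1}theta_1D rmorphD rmorph1 rmorphM rmorph_nat. Qed.

Lemma theta3_pow4 : a ^+ 4 = 1 + 8%:R * V 3 Y.
Proof. by rewrite -rmorphXn /= theta_pow4 rmorphD rmorph1 rmorphM rmorph_nat. Qed.

Lemma natr_inj m (F G : fps int) : (0 < m)%N -> m%:R * F = m%:R * G -> F = G.
Proof.
move=> m0 e; apply: fpsP => n; have := congr1 (fun F : fps int => F n) e.
rewrite /= !mulr_natl !fcoefMn => /eqP; rewrite eqrMn2r => /orP[|/eqP //]; lia.
Qed.

(** [theta_quartic] divided by 8; it eliminates [omega] from the image of f_2^3 a^5. *)
Lemma theta3_omega_cube : a * X * omega ^+ 3 = V 3 Y - Y.
Proof.
apply: (@natr_inj 8) => //; have := theta_quartic; rewrite theta_pow4.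
move: theta3_pow4; move: Y (V 3 Y) a => y x A e4 e.
have {}e : A ^+ 4 - 8%:R * (A * X * omega ^+ 3) = 1 + 8%:R * y by rewrite -e; ring.
rewrite e4 in e; transitivity (1 + 8%:R * x - (1 + 8%:R * y)); last by ring.
by rewrite -e; ring.
Qed.

Lemma theta_dissect3 : theta = V 3 a - 2%:R * (X * V 3 omega).
Proof. by rewrite {1}theta_dissect V_comp // mulrA. Qed.

Lemma U_add k r (F G : fps int) : U k r (F + G) = U k r F + U k r G.
Proof. exact: raddfD. Qed.

Lemma U_natM k r m (F : fps int) : U k r (m%:R * F) = m%:R * U k r F.
Proof. by rewrite !mulr_natl raddfMn. Qed.

Lemma dissect_pow4 (b w : fps int) : (V 3 b - 2%:R * (X * V 3 w)) ^+ 4 =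
  V 3 (b ^+ 4 - 32%:R * b * X * w ^+ 3)
  + X * V 3 (- (8%:R * b ^+ 3 * w) + 16%:R * X * w ^+ 4)
  + X ^+ 2 * V 3 (24%:R * b ^+ 2 * w ^+ 2).
Proof.
rewrite !(rmorph_nat, rmorphM, rmorphXn, rmorphN, rmorphD) /= V_X //.
by move: (V 3 b) (V 3 w) => B W; ring.
Qed.

Lemma dissect_pow5 (b w : fps int) : (V 3 b - 2%:R * (X * V 3 w)) ^+ 5 =
  V 3 (b ^+ 5 - 80%:R * b ^+ 2 * X * w ^+ 3)
  + X * V 3 (- (10%:R * b ^+ 4 * w) + 80%:R * b * X * w ^+ 4)
  + X ^+ 2 * V 3 (40%:R * b ^+ 3 * w ^+ 2 - 32%:R * X * w ^+ 5).
Proof.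
rewrite !(rmorph_nat, rmorphM, rmorphXn, rmorphN, rmorphD) /= V_X //.
by move: (V 3 b) (V 3 w) => B W; ring.
Qed.

Lemma U3_theta8 : [/\ U 3 0 Y = V 3 Y - 4%:R * a * X * omega ^+ 3,
  U 3 1 Y = - a ^+ 3 * omega + 2%:R * X * omega ^+ 4
  & U 3 2 Y = 3%:R * a ^+ 2 * omega ^+ 2].
Proof.
have e := dissect_pow4 a omega; rewrite -theta_dissect3 in e.
have {}e : 8%:R * Y = V 3 (8%:R * V 3 Y - 32%:R * a * X * omega ^+ 3)
    + X * V 3 (- (8%:R * a ^+ 3 * omega) + 16%:R * X * omega ^+ 4)
    + X ^+ 2 * V 3 (24%:R * a ^+ 2 * omega ^+ 2).
  have -> : 8%:R * Y = theta ^+ 4 - 1 by rewrite theta_pow4; ring.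
  have -> : 8%:R * V 3 Y = a ^+ 4 - 1 by rewrite theta3_pow4; ring.
  by rewrite e [a ^+ 4 - 1 - _]addrAC [V 3 (_ - 1)]rmorphB rmorph1; ring.
have [e0 e1 e2] := U3_eq (8%:R * V 3 Y - 32%:R * a * X * omega ^+ 3)
  (- (8%:R * a ^+ 3 * omega) + 16%:R * X * omega ^+ 4) (24%:R * a ^+ 2 * omega ^+ 2).
move: e0 e1 e2; rewrite -e !U_natM => e0 e1 e2.
split; apply: (@natr_inj 8) => //; rewrite ?e0 ?e1 ?e2; ring.
Qed.

Lemma f_cube k : (0 < k)%N -> f k ^+ 3 = V k jacobi.
Proof. by move=> k0; rewrite -rmorphXn /= euler_cube. Qed.

Lemma U3_K : [/\ U 3 0 K = V 2 jacobi0, U 3 1 K = 0 & U 3 2 K = - (3%:R * f 6 ^+ 3)].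
Proof.
have -> : K = V 3 (V 2 jacobi0) + X * V 3 0 + X ^+ 2 * V 3 (- (3%:R * f 6 ^+ 3)).
  rewrite !f_cube // {1}jacobi_dissect rmorph0 !(rmorphB, rmorphN, rmorphM, rmorph_nat) /=.
  by rewrite V_X // !V_comp //; ring.
exact: U3_eq.
Qed.

(** The indices 9n + 2 = 3(3n) + 2, in two steps because each 3-dissection is known in closed
    form. *)
Definition subprog (F : fps int) : fps int := U 3 0 (U 3 2 F).

Lemma subprogD F G : subprog (F + G) = subprog F + subprog G.
Proof. by rewrite /subprog !raddfD. Qed.
Lemma subprog_nat m F : subprog (m%:R * F) = m%:R * subprog F.
Proof. by rewrite /subprog !U_natM. Qed.

(** By Jacobi's identity the class 2 part of f_2^3 is -3 f_6^3, and f_6^3 is f_2^3 at q^3: an exact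
    eigenvector. *)
Lemma subprog_K : subprog K = - (3%:R * K).
Proof.
rewrite /subprog; have [_ _ ->] := U3_K.
by rewrite raddfN /= U_natM -(V_comp (j := 3) (k := 2)) // -rmorphXn /= U_V.
Qed.

Lemma U3_f6M r F : (r < 3)%N -> U 3 r (f 6 ^+ 3 * F) = K * U 3 r F.
Proof. by move=> r3; rewrite -(V_comp (j := 3) (k := 2)) // -rmorphXn U_VM. Qed.

(** The first extraction turns a^5 = theta(q^3)^5 into theta^5 and f_2^3 into -3 f_6^3; the second
    takes the class 0 part of theta^5, which is a^5 - 80 a^2 q omega^3. *)
Lemma subprog_Ka5 :
  subprog (K * a ^+ 5) = - (3%:R * K * (a ^+ 5 - 80%:R * a * (V 3 Y - Y))).
Proof.
have -> : K * a ^+ 5 = V 3 (theta ^+ 5) * K by rewrite rmorphXn mulrC.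
rewrite /subprog U_VM //; have [_ _ ->] := U3_K.
have -> : theta ^+ 5 * - (3%:R * f 6 ^+ 3) = - 3%:R * (f 6 ^+ 3 * theta ^+ 5) by ring.
rewrite mulNr raddfN /= U_natM U3_f6M //.
have e := dissect_pow5 a omega; rewrite -theta_dissect3 in e.
rewrite e.
have [-> _ _] := U3_eq (a ^+ 5 - 80%:R * a ^+ 2 * X * omega ^+ 3)
  (- (10%:R * a ^+ 4 * omega) + 80%:R * a * X * omega ^+ 4)
  (40%:R * a ^+ 3 * omega ^+ 2 - 32%:R * X * omega ^+ 5).
by rewrite -theta3_omega_cube; ring.
Qed.

Lemma subprog_Kx : cong 2 (subprog (K * V 3 Y)) (K * V 3 Y).
Proof.
rewrite /subprog mulrC U_VM //; have [_ _ ->] := U3_K; have [e0 _ _] := U3_theta8.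
have -> : Y * - (3%:R * f 6 ^+ 3) = - 3%:R * (f 6 ^+ 3 * Y) by ring.
rewrite mulNr raddfN /= U_natM U3_f6M // e0.
exists (- 2%:R * K * V 3 Y + 6%:R * K * a * X * omega ^+ 3).
by move: K (V 3 Y) => k x; ring.
Qed.

Lemma cong_odd m (F : fps int) k : cong m F 1 -> cong m (F ^+ k) 1.
Proof. by move/(congX k); rewrite expr1n. Qed.

Lemma theta3_odd : cong 2 a 1. Proof. by exists (V 3 S); exact: theta3_1D. Qed.
Lemma theta_odd : cong 2 theta 1. Proof. by exists S; exact: theta_1D. Qed.

(** Modulo 2, [jacobi0] is f_1 and both theta functions are 1, so this is [omega_theta] reduced. *)
Lemma jacobi0_omega : cong 2 (V 2 jacobi0 * omega ^+ 2) (f 6 ^+ 3).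
Proof.
apply: (cong_trans (congMr _ (congV 2 jacobi0_mod2))).
apply: (@cong_trans _ (f 2 * omega ^+ 2 * a)).
  by rewrite -[X in cong _ X]mulr1; apply/cong_sym/congMl/theta3_odd.
rewrite omega_theta -[X in cong _ _ X]mulr1; apply/congMl/theta_odd.
Qed.

(** In the product rule the class 1 part of f_2^3 vanishes, and modulo 2 the other two terms are
    f_6^3 and f_6^3 Y(q^3), from which the second extraction takes out f_2^3. *)
Lemma subprog_KY : cong 2 (subprog (K * Y)) (K + K * Y).
Proof.
apply: (@cong_trans _ (U 3 0 (f 6 ^+ 3 * (1 + V 3 Y)))); last first.
  rewrite U3_f6M // raddfD /= U_V // -(rmorph1 (V 3)) U_V // mulrDr mulr1.
  exact: cong_refl.
apply: congU; have [_ _ ->] := U3M K Y.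
have [-> -> ->] := U3_K; have [-> -> ->] := U3_theta8.
have [P eP] := jacobi0_omega; have [A eA] := cong_odd 2 theta3_odd.
exists (P + V 2 jacobi0 * omega ^+ 2 * (1 + 3%:R * A)
  + f 6 ^+ 3 * (- 2%:R * V 3 Y + 6%:R * a * X * omega ^+ 3)).
transitivity (V 2 jacobi0 * omega ^+ 2 + 2%:R * (V 2 jacobi0 * omega ^+ 2 * (1 + 3%:R * A))
  + f 6 ^+ 3 * (V 3 Y + 2%:R * (- 2%:R * V 3 Y + 6%:R * a * X * omega ^+ 3))).
  by rewrite eA; ring.
by rewrite eP; ring.
Qed.

Definition invariant (F : fps int) := exists c c1 c2 c3 : int,
  cong 32 F (c%:~R * (K * a ^+ 5)
    + 16%:R * (c1%:~R * K + c2%:~R * (K * V 3 Y) + c3%:~R * (K * Y))).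

Lemma U_intM k r (c : int) (F : fps int) : U k r (c%:~R * F) = c%:~R * U k r F.
Proof. by rewrite !mulrzl raddfMz. Qed.

Lemma subprog_int (c : int) F : subprog (c%:~R * F) = c%:~R * subprog F.
Proof. by rewrite /subprog !U_intM. Qed.

Lemma invariant_subprog F : invariant F -> invariant (subprog F).
Proof.
move=> [c [c1 [c2 [c3 /(congU 3 2)/(congU 3 0) e]]]].
(* Modulo 32 the error of [subprog_Ka5] is 16 c K (V 3 Y + Y), since 240 is 16 modulo 32 and a is
   odd; modulo 2, -3 c1 is c1, and K Y also contributes to K. *)
exists (- 3%:R * c), (c1 + c3), (c + c2), (c + c3); apply: cong_trans e _.
rewrite -!/(subprog _) !(subprogD, subprog_int, subprog_nat) subprog_K subprog_Ka5.
have [A ->] := subprog_Kx; have [B ->] := subprog_KY.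
move: Y K (V 3 Y) (V 3 S) a theta3_1D => y k x s b ->.
exists (k * c%:~R * (7%:R * x - 8%:R * y + 15%:R * s * (x - y)) - 2%:R * c1%:~R * k
  + c2%:~R * A + c3%:~R * B).
ring.
Qed.

Lemma U31_invariant F : invariant F -> cong 32 (U 2 1 (U 3 1 F)) 0.
Proof.
move=> [c [c1 [c2 [c3 /(congU 3 1)/(congU 2 1) e]]]]; apply: cong_trans e _.
have [k0 k1 k2] := U3_K.
rewrite !(U_add, U_intM, U_natM) k1.
rewrite [K * V 3 _]mulrC U_VM // k1 mulr0.
have -> : K * a ^+ 5 = V 3 (theta ^+ 5) * K by rewrite rmorphXn mulrC.
rewrite U_VM // k1 mulr0 !raddf0 !mulr0 !add0r.
have [_ -> _] := U3M K Y; rewrite k0 k1 k2; have [-> -> ->] := U3_theta8.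
(* Neither K nor K times a series in q^3 has a part in class 1, so only 16 c3 K Y survives and a
   parity is enough. *)
set Z := _ + _; suff [H ->] : cong 2 (U 2 1 Z) 0.
  by exists (c3%:~R * H); rewrite !add0r; ring.
have [A eA] := cong_odd 3 theta3_odd; have [B eB] := cong_odd 2 theta3_odd.
apply: (@cong_trans _ (U 2 1 (V 2 jacobi0 * omega + V 2 (f 3 ^+ 3) * (X * omega ^+ 2)))).
  apply: congU; rewrite /Z eA eB.
  exists (V 2 jacobi0 * (- omega - A * omega + X * omega ^+ 4)
    - f 6 ^+ 3 * X * omega ^+ 2 * (5%:R + 9%:R * B)).
  by rewrite rmorphXn /= V_comp //; move: omega (f 6) (V 2 jacobi0) => w f j; ring.
rewrite raddfD /= !U_VM //.
(* Modulo 2 the odd part of [omega] is omega(q^2), that is omega^2, and the odd part of q omega^2 is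
   [omega]; both terms then equal f_3^3 omega and cancel. *)
apply: (@cong_trans _ (euler * omega ^+ 2 + f 3 ^+ 3 * omega)).
  apply: congD.
    apply: congM; first exact: jacobi0_mod2.
    apply: (cong_trans omega_odd_mod2); apply: cong_sym; exact: frobenius.
  apply: congMl; apply: (@cong_trans _ (U 2 1 (X * V 2 omega))).
    by apply/congU/congMl/frobenius.
  by have := @U_XnV _ 2 1 1 omega isT isT; rewrite expr1 => ->; apply: cong_refl.
(* From omega f_2 f_3 = f_1 f_6^2 with f_2 = f_1^2 and f_6 = f_3^2 modulo 2, after cancelling f_1
   f_3. *)
have eo : cong 2 (euler * omega) (f 3 ^+ 3).
  apply: (@cong_unit _ (euler * f 3)); first by rewrite fcoefM0 V_euler0 euler0 mulr1.
  apply: (@cong_trans _ (omega * f 2 * f 3)).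
    have -> : euler * f 3 * (euler * omega) = omega * euler ^+ 2 * f 3 by ring.
    by apply/congMr/congMl/frobenius.
  rewrite omega_euler.
  have -> : euler * f 3 * f 3 ^+ 3 = euler * (f 3 ^+ 2) ^+ 2 by ring.
  apply/congMl/congX/cong_sym; have := frobenius (f 3); by rewrite V_comp.
case: eo => H eH; exists (f 3 ^+ 3 * omega + omega * H).
have -> : euler * omega ^+ 2 = euler * omega * omega by ring.
by rewrite eH; ring.
Qed.

Lemma dissect_cube (b w : fps int) :
  (V 3 b - 2%:R * (X * V 3 w)) * (V 3 b ^+ 2 + 2%:R * V 3 b * (X * V 3 w)
    + 4%:R * (X * V 3 w) ^+ 2) = V 3 (b ^+ 3 - 8%:R * X * w ^+ 3).
Proof.
rewrite !(rmorph_nat, rmorphM, rmorphXn, rmorphB) /= V_X //.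
by move: (V 3 b) (V 3 w) => B W; ring.
Qed.

Lemma dissect_square (b w : fps int) :
  V 3 b ^+ 2 + 2%:R * V 3 b * (X * V 3 w) + 4%:R * (X * V 3 w) ^+ 2 =
  V 3 (b ^+ 2) + X * V 3 (2%:R * b * w) + X ^+ 2 * V 3 (4%:R * w ^+ 2).
Proof.
rewrite !(rmorph_nat, rmorphM, rmorphXn) /=.
by move: (V 3 b) (V 3 w) => B W; ring.
Qed.

Lemma dissect_sixth (b w : fps int) :
  (V 3 b ^+ 2 + 2%:R * V 3 b * (X * V 3 w) + 4%:R * (X * V 3 w) ^+ 2) ^+ 3 =
  V 3 (b ^+ 6 + 56%:R * b ^+ 3 * X * w ^+ 3 + 64%:R * X ^+ 2 * w ^+ 6)
  + X * V 3 (6%:R * b ^+ 5 * w + 96%:R * b ^+ 2 * X * w ^+ 4)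
  + X ^+ 2 * V 3 (24%:R * b ^+ 4 * w ^+ 2 + 96%:R * b * X * w ^+ 5).
Proof.
rewrite !(rmorph_nat, rmorphM, rmorphXn, rmorphD) /= V_X //.
by move: (V 3 b) (V 3 w) => B W; ring.
Qed.

(** * The series f_6 / theta and its indices 9n + 2 *)

Section Regular.
Variable G : fps int.
Hypothesis GE : G * euler ^+ 2 = f 2 * f 6.

Lemma regular_theta : G * theta = f 6.
Proof.
apply: (@fps_lcancel _ (f 2)); first exact: V_euler0.
by rewrite -GE -theta_euler; ring.
Qed.

Definition theta_norm3 : fps int := a ^+ 3 - 8%:R * X * omega ^+ 3.

Lemma theta_norm3E : a * theta_norm3 = theta ^+ 4.
Proof. exact: theta_quartic. Qed.

(** The product of the two other conjugates of [theta], which makes the denominator of f_6 / theta a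
    series in q^3. *)
Definition theta_conorm : fps int := V 3 a ^+ 2 + 2%:R * V 3 a * (X * V 3 omega)
  + 4%:R * (X * V 3 omega) ^+ 2.

Lemma theta_conormE : theta * theta_conorm = V 3 theta_norm3.
Proof.
by rewrite {1}theta_dissect3 dissect_cube.
Qed.

Lemma regular_norm3 : G * V 3 theta_norm3 = V 3 (f 2) * theta_conorm.
Proof. by rewrite -theta_conormE mulrA regular_theta V_comp. Qed.

(** Only 4 omega^2 in the conorm lies in class 2; multiplying by a turns the norm into theta^4 and
    f_2 omega^2 into f_6^3 theta / a. *)
Lemma regular_2mod3 : U 3 2 G * theta ^+ 3 = 4%:R * f 6 ^+ 3.
Proof.
have e : theta_conorm = _ := dissect_square a omega.
have [_ _ u2] := U3_eq (a ^+ 2) (2%:R * a * omega) (4%:R * omega ^+ 2).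
have := congr1 (U 3 2) regular_norm3; rewrite mulrC !U_VM // e u2 => e1.
apply: (@fps_lcancel _ theta); first exact: theta0.
transitivity (theta_norm3 * U 3 2 G * a).
  by rewrite mulrCA -exprS -theta_norm3E; ring.
rewrite e1; transitivity (4%:R * (f 2 * omega ^+ 2 * a)); first by ring.
by rewrite omega_theta; ring.
Qed.

Lemma subprog_regular : subprog G * theta ^+ 12 =
  4%:R * K * (a * (9%:R * a ^+ 8 - 9%:R * a ^+ 4 * theta ^+ 4 + theta ^+ 8)).
Proof.
pose A := a ^+ 6 + 56%:R * a ^+ 3 * X * omega ^+ 3 + 64%:R * X ^+ 2 * omega ^+ 6.
pose B := 6%:R * a ^+ 5 * omega + 96%:R * a ^+ 2 * X * omega ^+ 4.
pose C := 24%:R * a ^+ 4 * omega ^+ 2 + 96%:R * a * X * omega ^+ 5.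
have e : theta_conorm ^+ 3 = V 3 A + X * V 3 B + X ^+ 2 * V 3 C := dissect_sixth a omega.
have [u0 _ _] := U3_eq A B C.
have : V 3 (theta_norm3 ^+ 3) * U 3 2 G = 4%:R * V 3 K * theta_conorm ^+ 3.
  rewrite !rmorphXn /= -theta_conormE V_comp // exprMn mulrAC.
  rewrite -[theta ^+ 3 * _]mulrC regular_2mod3.
  by rewrite mulrA.
move/(congr1 (U 3 0)); rewrite U_VM // -mulrA U_natM U_VM // e u0 -/(subprog G) => e1.
transitivity (theta_norm3 ^+ 3 * subprog G * a ^+ 3).
  by rewrite (_ : 12 = 4 * 3)%N // exprM -theta_norm3E;
  move: (subprog G) a theta_norm3 => g b d; ring.
rewrite e1.
(* With N the norm and u = 8 q omega^3 = a^3 - N, the class 0 part of the cubed conorm is a^6 + 7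
   a^3 u + u^2 = 9 a^6 - 9 a^3 N + N^2. *)
have -> : theta ^+ 8 = (a * theta_norm3) ^+ 2 by rewrite theta_norm3E -exprM.
rewrite -theta_norm3E /A /theta_norm3.
by move: K a omega => k b w; ring.
Qed.

Lemma subprog_regular_mod128 : cong 128 (subprog G) (4%:R * (K * a ^+ 5 + 16%:R * (K * Y))).
Proof.
apply: (@cong_unit _ (theta ^+ 12)); first by rewrite exp_coef0 ?theta0.
rewrite mulrC subprog_regular.
have -> : theta ^+ 12 = (theta ^+ 4) ^+ 3 by rewrite -exprM.
have -> : theta ^+ 8 = (theta ^+ 4) ^+ 2 by rewrite -exprM.
rewrite (_ : 9%:R * a ^+ 8 = 9%:R * (a ^+ 4) ^+ 2); last by ring.
have -> : a ^+ 5 = a ^+ 4 * a by ring.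
rewrite theta_pow4 theta3_pow4.
move: Y K (V 3 Y) (V 3 S) a theta3_1D => y k x s b eb.
(* After division by 4k the two sides differ modulo 32 by a multiple of 16 y (b + 1), which vanishes
   because b = 1 + 2s; the witness is the full expansion divided by 128. *)
exists (k * (b * (2%:R * x + 18%:R * x ^+ 2 - 24%:R * x * y - 4%:R * y ^+ 2 - 16%:R * y ^+ 3
   - 48%:R * x * y ^+ 2 - 128%:R * x * y ^+ 3) - 3%:R * y - 5%:R * s * y
   - 12%:R * y ^+ 2 - 96%:R * y ^+ 3 - 256%:R * y ^+ 4)).
by rewrite eb; ring.
Qed.

Lemma iter_subprog k F n : iter k subprog F n = F (9 ^ k * n + (9 ^ k - 1) %/ 4)%N.
Proof.
have d4 j : (4 * ((9 ^ j - 1) %/ 4) = 9 ^ j - 1)%N.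
  suff d : (4 %| 9 ^ j - 1)%N by rewrite mulnC divnK.
  elim: j => // j IH; rewrite expnS.
  have -> : (9 * 9 ^ j - 1 = 8 * 9 ^ j + (9 ^ j - 1))%N by have := expn_gt0 9 j; lia.
  by rewrite dvdn_addr // dvdn_mulr.
elim: k n => [|k IH] n; first by rewrite mul1n addn0.
rewrite [LHS]/= IH; congr (fps_coef F); have := d4 k; have := d4 k.+1.
rewrite expnS; have := expn_gt0 9 k; nia.
Qed.

Lemma regular_mod128 k n :
  (128 %| G (18 * 3 ^ (2 * k + 1) * n + (153 * 3 ^ (2 * k) - 1) %/ 4)%N)%Z.
Proof.
(* The index is the image of 6n + 4 = 3(2n + 1) + 1 under k + 1 steps; this final form matches
   [U 3 1] followed by [U 2 1]. *)
have -> : (18 * 3 ^ (2 * k + 1) * n + (153 * 3 ^ (2 * k) - 1) %/ 4 =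
  9 ^ k.+1 * (3 * (2 * n + 1) + 1) + (9 ^ k.+1 - 1) %/ 4)%N.
  have e3 : (3 ^ (2 * k) = 9 ^ k)%N by rewrite expnM.
  rewrite addn1 !expnS e3.
  have := expn_gt0 9 k; move: (9 ^ k)%N => t t0.
  have -> : (153 * t - 1 = 36 * t * 4 + (9 * t - 1))%N by lia.
  by rewrite divnMDl //; lia.
rewrite -iter_subprog iterSr.
have [F iF] : exists2 F, invariant F & cong 128 (iter k subprog (subprog G)) (4%:R * F).
  elim: k => [|k [F iF c]].
    exists (K * a ^+ 5 + 16%:R * (K * Y)); last exact: subprog_regular_mod128.
    exists 1, 0, 0, 1; rewrite !mul1r !mul0r !add0r; exact: cong_refl.
  exists (subprog F); first exact: invariant_subprog.
  by rewrite -subprog_nat; apply/congU/congU.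
move/(congU 3 1)/(congU 2 1) => c.
have := cong_trans c; rewrite !U_natM => {}c.
have {}c := c _ (cong_scale 4 (U31_invariant iF)); rewrite mulr0 in c.
by have := (congP _ _ _).1 c n; rewrite subr0.
Qed.

End Regular.

End ThetaIdentities.

(** * The generating function of regular overpartitions *)

(** Cardinality of a finite predicate on an infinite type, given by a duplicate-free enumeration and
    valued in [int] to match coefficients. *)
Definition counts (T : eqType) (P : pred T) (c : int) :=
  exists L : seq T, [/\ uniq L, forall x, (x \in L) = P x & (size L)%:Z = c].

Section Counts.
Variable T : eqType.
Implicit Types P Q : pred T.

Lemma eq_counts P Q c : P =1 Q -> counts P c -> counts Q c.
Proof. by move=> e [L [uL mL sL]]; exists L; split=> // x; rewrite mL e. Qed.

Lemma counts_unique P c d : counts P c -> counts P d -> c = d.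
Proof.
move=> [L [uL mL <-]] [M [uM mM <-]]; congr _%:Z; apply/perm_size/uniq_perm => // x.
by rewrite mL mM.
Qed.

Lemma counts0 : counts (pred0 : pred T) 0.
Proof. by exists [::]. Qed.

Lemma countsU P Q c d : (forall x, ~~ (P x && Q x)) -> counts P c -> counts Q d ->
  counts (predU P Q) (c + d).
Proof.
move=> dis [L [uL mL <-]] [M [uM mM <-]]; exists (L ++ M); split.
- rewrite cat_uniq uL uM andbT /=; apply/hasPn => x; rewrite mM => Qx.
  by rewrite mL; have := dis x; rewrite Qx andbT.
- by move=> x; rewrite mem_cat mL mM.
by rewrite size_cat PoszD.
Qed.

Lemma counts_cons (y : T) (Q : pred (seq T)) d : counts Q d ->
  counts (fun s => if s is z :: t then (z == y) && Q t else false) d.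
Proof.
move=> [M [uM mM <-]]; exists (map (cons y) M); split; last by rewrite size_map.
  by rewrite map_inj_uniq // => s t [].
move=> [|z t]; first by apply/mapP => -[].
apply/mapP/andP => [[u uinM [-> ->]]|[/eqP-> Qt]]; first by rewrite eqxx -mM.
by exists t; rewrite ?mM.
Qed.

End Counts.

Section Overpartitions.
Variable l : nat.

(** The flag b splits the admission of the part m in two: first its plain copies ([false]), then an
    overlined one ([true]), matching one denominator and one numerator factor. *)
Definition bounded m b (p : nat * bool) := (p.1 < m)%N || (p.1 == m) && (b || ~~ p.2).

Definition admissible m b n s :=
  [&& is_overpartition n s, R_star_ok l s & all (bounded m b) s].

Lemma op_rel_trans : transitive op_rel.
Proof.
move=> [b b'] [a a'] [c c']; rewrite /op_rel /=; case: b'; case: a'; case: c'; lia.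
Qed.

Lemma admissible_nil m b n : admissible m b n [::] = (n == 0).
Proof. by rewrite /admissible /is_overpartition /= andbT eq_sym. Qed.

(** Only the first copy of a part may be overlined, so the tail is bounded by the leading part with
    flag [false]. *)
Lemma admissible_cons m b n x t : admissible m b n (x :: t) =
  [&& bounded m b x, 0 < x.1, x.2 || ~~ (l %| x.1), x.1 <= n
    & admissible x.1 false (n - x.1) t]%N.
Proof.
rewrite /admissible /is_overpartition /= (path_sortedE op_rel_trans).
have -> : (x.1 + sumn (map fst t) == n) = (x.1 <= n)%N && (sumn (map fst t) == n - x.1)%N.
  by case: leqP; lia.
have e : bounded m b x ->
    all (op_rel x) t = all (bounded m b) t && all (bounded x.1 false) t.
  move=> bx; rewrite (_ : all (op_rel x) t = all (bounded x.1 false) t) //.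
  case ax : (all (bounded x.1 false) t); rewrite ?andbF // andbT.
  apply/esym/allP => y yt; move/allP/(_ y yt): ax; move: bx {yt}.
  by case: x y b => a [] [c []] [] /=; rewrite /bounded /=; lia.
case bx : (bounded m b x); last by rewrite !(andFb, andbF).
rewrite e // /R_star_ok /=.
case: (0 < x.1)%N; case: (x.2 || _); case: (x.1 <= n)%N; rewrite ?andbF ?andbT //=.
case: (sorted op_rel t); case: (all (bounded m b) t); case: (all (bounded x.1 false) t);
  by rewrite ?andbF ?andbT.
Qed.

Definition generates m b (F : fps int) := forall n, counts (admissible m b n) (F n).

Lemma generates0 : generates 0 true 1.
Proof.
move=> n.
have e : (fun s : seq (nat * bool) => (s == [::]) && (n == 0)) =1 admissible 0 true n.
  move=> [|[a c] t]; first by rewrite admissible_nil eqxx.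
  by rewrite admissible_cons /bounded /=; lia.
apply: (eq_counts e); rewrite fcoef1; case: eqP => _.
  by exists [:: [::]]; split=> // x; rewrite andbT inE.
by exists [::]; split=> // x; rewrite andbF.
Qed.

(** An overlined m can occur only in front, and is then followed by a sequence with flag [false]. *)
Lemma generates_overlined m F : (0 < m)%N -> generates m false F ->
  generates m true (F * (1 + fps_X ^+ m)).
Proof.
move=> m0 gF n; rewrite mulrDr mulr1 mulrC fcoefD fcoefXnM.
have cQ : counts (fun s => if s is z :: t then (z == (m, true)) &&
    ((m <= n)%N && admissible m false (n - m) t) else false)
    (if (n < m)%N then 0 else F (n - m)%N).
  apply: counts_cons; case: ltnP => _ /=; [exact: counts0|exact: gF].
apply: eq_counts (countsU _ (gF n) cQ) => [[|[a c] t] /=|[|[a c] t] /=].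
- by rewrite !admissible_nil orbF.
- rewrite /= !admissible_cons xpair_eqE /bounded /=.
  case: (eqVneq a m) => [->|ne].
    by rewrite ltnn m0; case: c => //=; rewrite ?orbF.
  by rewrite !andFb !orbF.
- by rewrite andbF.
rewrite admissible_cons xpair_eqE /bounded /=.
by case: (eqVneq a m) => [->|ne]; case: c; rewrite ?ltnn ?andbF ?andFb.
Qed.

(** Removing a leading plain m + 1 leaves an object of the same kind, so F' = F + q^(m+1) F' unless
    l divides m + 1, when no such part exists; hence the strong induction on n. *)
Lemma generates_plain m F F' : generates m true F ->
  F' * (if (l %| m.+1)%N then 1 else 1 - fps_X ^+ m.+1) = F -> generates m.+1 false F'.
Proof.
move=> gF eF n; have [N] := ubnP n; elim: N n => // N IH n ltn.
have -> : F' n = F n + (if (l %| m.+1)%N || (n < m.+1)%N then 0 else F' (n - m.+1)%N).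
  case: ifP eF => _ <-; first by rewrite mulr1 addr0.
  by rewrite mulrBr mulr1 fcoefB mulrC fcoefXnM; case: ifP => _ /=; ring.
have cQ : counts (fun s => if s is z :: t then (z == (m.+1, false)) &&
    (~~ ((l %| m.+1)%N || (n < m.+1)%N) && admissible m.+1 false (n - m.+1) t) else false)
    (if (l %| m.+1)%N || (n < m.+1)%N then 0 else F' (n - m.+1)%N).
  apply: counts_cons; case: ifP => [_|/norP[_]] /=; first exact: counts0.
  by rewrite -leqNgt => le; apply: IH; lia.
apply: eq_counts (countsU _ (gF n) cQ) => [[|[a c] t] /=|[|[a c] t] /=].
- by rewrite !admissible_nil orbF.
- rewrite /= !admissible_cons xpair_eqE /bounded /=.
  case: (eqVneq a m.+1) => [->|ne].
    rewrite ltnn (gtn_eqF (ltnSn m)) (ltnNge m.+1) leqW //.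
    by case: c; rewrite //= negb_or -leqNgt andbA.
  by rewrite andFb !orbF andbT; congr (_ && _); rewrite orbC -leq_eqVlt ltnS.
- by rewrite andbF.
rewrite admissible_cons xpair_eqE /bounded /=.
case: (eqVneq a m.+1) => [->|ne]; rewrite ?andbF ?andFb //.
by rewrite (gtn_eqF (ltnSn m)) (ltnNge m.+1) leqW.
Qed.

Definition den i : fps int := if (l %| i.+1)%N then 1 else 1 - fps_X ^+ i.+1.
Definition num i : fps int := 1 + fps_X ^+ i.+1.

Lemma generates_exists m : exists2 F, generates m true F &
  F * \prod_(i < m) den i = \prod_(i < m) num i.
Proof.
elim: m => [|m [F gF eF]]; first by exists 1; [exact: generates0|rewrite !big_ord0 mulr1].
have den0 : den m 0%N = 1.
  by rewrite /den; case: ifP => // _; rewrite fcoefB fcoefXn.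
have [D eD] := fps_unit den0.
exists (F * D * (1 + fps_X ^+ m.+1)).
  apply: generates_overlined => //; apply: generates_plain gF _.
  by rewrite -/(den m) -mulrA [D * _]mulrC eD mulr1.
rewrite !big_ord_recr /= -eF /num.
transitivity (F * \prod_(i < m) den i * (den m * D) * (1 + fps_X ^+ m.+1)); first by ring.
by rewrite eD mulr1.
Qed.

Lemma sum_parts_le s (x : nat * bool) : x \in s -> (x.1 <= sumn (map fst s))%N.
Proof.
by elim: s => //= y s IH; rewrite inE => /orP[/eqP->|/IH]; lia.
Qed.

Lemma size_le_sum (s : seq (nat * bool)) :
  all (fun p => 0 < p.1)%N s -> (size s <= sumn (map fst s))%N.
Proof. by elim: s => //= y s IH /andP[y0 /IH]; lia. Qed.

Lemma mem_all_seqs (T : eqType) (A : seq T) k s :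
  (s \in all_seqs A k) = (size s == k) && all (mem A) s.
Proof.
elim: k s => [|k IH] [|x s] //=; first by apply/negbTE/allpairsP => -[[? ?] []].
apply/allpairsP/and3P => [[[y t] /= [yA]]|[e xA sA]].
  by rewrite IH => /andP[/eqP<- tA] [-> ->].
by exists (x, s); rewrite IH sA andbT.
Qed.

Lemma all_seqs_uniq (T : eqType) (A : seq T) k : uniq A -> uniq (all_seqs A k).
Proof.
move=> uA; elim: k => //= k IH.
by apply: allpairs_uniq => // -[? ?] [? ?] _ _ [-> ->].
Qed.

Lemma op_candidates_uniq n : uniq (op_candidates n).
Proof.
rewrite /op_candidates; set A := [seq (a, b) | a <- iota 1 n, b <- [:: true; false]].
have uA : uniq A.
  apply: allpairs_uniq; [exact: iota_uniq|by []|by move=> [? ?] [? ?] _ _ [-> ->]].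
elim: (iota 0 n.+1) (iota_uniq 0 n.+1) => //= k ks IH /andP[kks uks].
rewrite cat_uniq all_seqs_uniq ?IH // andbT /=; apply/hasPn => s /flatten_mapP[j jks].
rewrite !mem_all_seqs => /andP[/eqP-> _]; apply: contra kks => /andP[/eqP<- _] //.
Qed.

(** An overpartition of n has parts and length at most n, so the candidate list misses none and the
    bound m >= n excludes none. *)
Lemma Rbar_star_counts m n : (n <= m)%N ->
  counts (admissible m true n) (Rbar_star l n)%:Z.
Proof.
move=> le; exists [seq s <- op_candidates n | is_overpartition n s && R_star_ok l s].
split; [by rewrite filter_uniq ?op_candidates_uniq| |by rewrite size_filter].
move=> s; rewrite mem_filter /admissible andbA.
case ok : (is_overpartition n s && _) => //=.
have /andP[/and3P[_ pos /eqP sn] _] := ok.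
transitivity true.
  apply/flatten_mapP; exists (size s).
    by rewrite mem_iota /= add0n ltnS -sn size_le_sum.
  rewrite mem_all_seqs eqxx; apply/allP => -[a b] xs; apply/allpairsP; exists (a, b).
  have := sum_parts_le xs; have := allP pos _ xs; rewrite /= mem_iota sn => a0 an.
  by split=> //; [lia|case: b {xs}].
apply/esym/allP => x /sum_parts_le; rewrite sn /bounded /= andbT orbC -leq_eqVlt => xn.
exact: leq_trans xn le.
Qed.

Lemma multipliable_den : multipliable den.
Proof.
move=> k; rewrite /den; case: ifP => // _.
exact: (@multipliable_1BX int (fun i => i.+1)).
Qed.

Lemma multipliable_num : multipliable num.
Proof. by apply: (@multipliable1X _ _ (fun=> 1) S) => // k; rewrite mulr1. Qed.

Lemma Rbar_star_series :
  Fps (fun n => (Rbar_star l n)%:Z) * iprod den = iprod num.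
Proof.
apply: agreeP => n; have [F gF eF] := generates_exists n.
apply: agree_trans (agree_sym (agree_le (leqnSn n) (iprod_agree multipliable_num))).
rewrite -eF; apply: agreeM; last exact: agree_le (leqnSn n) (iprod_agree multipliable_den).
move=> i lt /=; apply: counts_unique (gF i); apply: Rbar_star_counts; exact: ltnW.
Qed.

Lemma Rbar_star_euler : (0 < l)%N ->
  Fps (fun n => (Rbar_star l n)%:Z) * euler int ^+ 2 = V 2 (euler int) * V l (euler int).
Proof.
move=> l0; have nE : iprod num * euler int = V 2 (euler int).
  rewrite /euler iprodM; [|exact: multipliable_num|exact: multipliable_1BX].
  rewrite -/(euler int) V_euler //; apply: eq_iprod => i.
  by rewrite /num mulnC exprM; ring.
have dE : iprod den * V l (euler int) = euler int.
  (* The factors absent from [den] are those with exponent divisible by l, and they form f_l. *)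
  pose g i : fps int := if (l %| i.+1)%N then 1 - fps_X ^+ i.+1 else 1.
  have mg : multipliable g.
    move=> k; rewrite /g; case: ifP => // _.
    exact: (@multipliable_1BX int (fun i => i.+1)).
  have -> : V l (euler int) = iprod g.
    rewrite (iprod_dissect l0 mg) V_euler // -(prednK l0) big_ord_recr /= big1 => [|c _].
      rewrite mul1r; apply: eq_iprod => i; rewrite /g.
      have -> : (l.-1.+1 * i + l.-1).+1 = (l.-1.+1 * i.+1)%N by lia.
      by rewrite prednK // dvdn_mulr.
    rewrite -[RHS](iprod1 int); apply: eq_iprod => i; rewrite /g ifN // prednK // -addnS.
    rewrite dvdn_addr ?dvdn_mulr //; apply/negP => /dvdn_leq /=.
    by have := ltn_ord c; lia.
  rewrite iprodM //; last exact: multipliable_den.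
  by apply: eq_iprod => i; rewrite /den /g; case: ifP; rewrite ?mul1r ?mulr1.
rewrite -nE -Rbar_star_series expr2 mulrA; move: (Fps _) => G.
by rewrite -[X in G * X * _]dE mulrA mulrAC.
Qed.

End Overpartitions.

Close Scope ring_scope.

Theorem theorem1p1 (n k : nat) :
  128 %| Rbar_star 6 (18 * 3 ^ (2 * k + 1) * n + (153 * 3 ^ (2 * k) - 1) %/ 4).
Proof.
exact: (@regular_mod128 _ (Rbar_star_euler (l := 6) isT) k n).
Qed.
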